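(* Let $V$ be a DVR with quotient field $K$ and perfect residue field $k_v$. The following statements are equivalent. (1) $[\overline{k_v}:k_v]=\infty$. (2) There is $\alpha\in\mathbb{K}\setminus\overline{\widehat K}$ (necessarily transcendental over $K$, so that $V_{\alpha}$ is defined) with $V_{\alpha}$ a DVR. (3) There is an extension $W$ of $V$ to $K(X)$ which is a DVR and residually algebraic over $V$, with $[k_w:k_v]=\infty$, where $k_w$ is the residue field of $W$. These conditions hold precisely when $k_v$ is neither algebraically closed nor real closed; in particular they hold whenever $k_v$ is finite, and whenever $k_v$ is a number field.
   Context: A DVR is a discrete valuation domain of rank one (value group isomorphic to $\mathbb{Z}$). $V$ is a DVR with quotient field $K$ and associated valuation $v$; $X$ is an indeterminate over $K$. An extension of $V$ to $K(X)$ is a valuation domain $W$ of $K(X)$ with $W\cap K=V$; it is residually algebraic over $V$ if its residue field is algebraic over $k_v$. $\overline{k_v}$ is an algebraic closure of $k_v$. $\widehat K$ is the $v$-adic completion of $K$, $\overline{\widehat K}$ an algebraic closure of $\widehat K$, and $v$ also denotes its unique extension to $\overline{\widehat K}$; $\mathbb{K}$ is the completion of $\overline{\widehat K}$ with respect to $v$, with the extended valuation again denoted $v$. For $\alpha\in\mathbb{K}$ transcendental over $K$, put $V_\alpha=\{\phi\in K(X)\mid v(\phi(\alpha))\ge 0\}$, a valuation domain of $K(X)$. *)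

(* Defs.v *)
From HB Require Import structures.
From mathcomp Require Import all_boot all_order all_algebra all_field.
From mathcomp Require Import constructive_ereal.

Set Implicit Arguments.
Unset Strict Implicit.
Unset Printing Implicit Defensive.

Import Order.TTheory GRing.Theory Num.Theory.
Local Open Scope ring_scope.
Local Open Scope quotient_scope.

(* Every valuation in play has value group inside the divisible hull Q of Z:
   discrete ones, their extensions to algebraic extensions, and the extensions
   of those to completions.  The value +oo is taken at 0 only. *)
Record valuation (F : fieldType) := Valuation {
  val_fun :> F -> \bar rat;
  val0 : val_fun 0 = +oo%E;
  val_fin : forall x, x != 0 -> val_fun x \is a fin_num;
  valM : forall x y, val_fun (x * y) = (val_fun x + val_fun y)%E;
  valD : forall x y,
    (Order.min (val_fun x) (val_fun y) <= val_fun (x + y))%E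
}.

(* The value group is exactly Z. *)
Definition normalized (F : fieldType) (v : valuation F) : Prop :=
  forall q : rat, (exists2 x, x != 0 & v x = q%:E) <-> q \is a Num.int.

Record valuation_ring (F : fieldType) := ValuationRing {
  vring :> {pred F};
  vring1 : 1 \in vring;
  vringB : forall x y, x \in vring -> y \in vring -> x - y \in vring;
  vringM : forall x y, x \in vring -> y \in vring -> x * y \in vring;
  vringV : forall x, x != 0 -> (x \in vring) || (x^-1 \in vring)
}.

(* Such a W is automatically a subring of F with quotient field F. *)
Definition DVR_with_valuation (F : fieldType) (W : {pred F})
    (v : valuation F) : Prop :=
  normalized v /\ forall x, (x \in W) = (0 <= v x)%E.

Definition is_DVR (F : fieldType) (W : {pred F}) : Prop :=
  exists v : valuation F, DVR_with_valuation W v.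

(* W :&: K = V, where K is seen in L through f. *)
Definition extends_ring (K L : fieldType) (f : K -> L)
    (V : {pred K}) (W : {pred L}) : Prop :=
  forall x, (f x \in W) = (x \in V).

Definition extends_valuation (K L : fieldType) (f : K -> L)
    (v : valuation K) (w : valuation L) : Prop :=
  forall x, w (f x) = v x.

Section ResidueField.
Variables (F : fieldType) (V : valuation_ring F).

Fact vring_subring_closed : subring_closed V.
Proof. by split; [exact: vring1 | exact: vringB | exact: vringM]. Qed.

HB.instance Definition _ :=
  GRing.isSubringClosed.Build F (V : {pred F}) vring_subring_closed.

Record vring_elt := VringElt {
  vring_val :> F;
  vring_valP : vring_val \in (V : {pred F})
}.

HB.instance Definition _ := [isSub for vring_val].
HB.instance Definition _ := [Choice of vring_elt by <:].
HB.instance Definition _ :=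
  [SubChoice_isSubComNzRing of vring_elt by <:].

(* The non-units of V; the case x = 0 is apart because 0^-1 = 0 in F. *)
Definition max_ideal : {pred vring_elt} :=
  [pred x | (val x == 0) || ((val x)^-1 \notin (V : {pred F}))].

Fact max_ideal_closed : idealr_closed max_ideal.
Proof.
have mulV (x y : F) : x \in (V : {pred F}) -> y \in (V : {pred F}) ->
    x * y \in (V : {pred F}) by exact: vringM.
have mI (a u : vring_elt) : u \in max_ideal -> a * u \in max_ideal.
  rewrite !inE /= mulf_eq0; have [->|a0] := eqVneq (val a) 0; first by [].
  have [->|u0] := eqVneq (val u) 0; first by [].
  rewrite /= invfM; apply: contra => auV.
  have := mulV _ _ (valP a) auV.
  by rewrite mulrA divff // mul1r.
have mD (x y : vring_elt) : x \in max_ideal -> y \in max_ideal ->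
    x + y \in max_ideal.
  wlog xyV : x y / val x / val y \in (V : {pred F}).
    move=> H xm ym; have [x0|x0] := eqVneq (val x) 0.
      by apply: H => //; rewrite x0 mul0r -(subrr 1) vringB ?vring1.
    have [y0|y0] := eqVneq (val y) 0.
      by rewrite addrC; apply: H => //; rewrite y0 mul0r -(subrr 1) vringB ?vring1.
    have /orP[xyV|] := @vringV _ V (val x / val y) (mulf_neq0 x0 (invr_neq0 y0)).
      exact: H.
    by rewrite invf_div => yxV; rewrite addrC; apply: H.
  have [y0|y0] := eqVneq (val y) 0.
    have -> : x + y = x by apply: val_inj; rewrite /= y0 addr0.
    by [].
  move=> _ ym; set t : vring_elt := VringElt xyV + 1.
  have -> : x + y = t * y; last exact: mI.
  by apply: val_inj; rewrite /= mulrDl mul1r divfK.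
split.
- by rewrite inE /= eqxx.
- by rewrite inE /= oner_eq0 invr1 vring1.
- by move=> a u w um wm; apply: mD => //; apply: mI.
Qed.

HB.instance Definition _ := isIdealr.Build vring_elt max_ideal max_ideal_closed.

Definition residue_field : Type := {ideal_quot max_ideal}.

HB.instance Definition _ := GRing.ComNzRing.on residue_field.

Definition residue (x : vring_elt) : residue_field := \pi_{ideal_quot max_ideal} x.

Definition residue_inv (y : residue_field) : residue_field :=
  residue (insubd 0 (val (repr y))^-1).

Fact residue_mulVf (y : residue_field) : y != 0 -> residue_inv y * y = 1.
Proof.
rewrite -[y in y != 0]reprK -(rmorph0 (\pi_{ideal_quot max_ideal})).
rewrite -Quotient.idealrBE subr0 inE negb_or negbK => /andP[y0 yV].
rewrite /residue_inv -[y in _ * y]reprK -rmorphM -[RHS](rmorph1 (\pi_{ideal_quot max_ideal})).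
congr (\pi_{ideal_quot max_ideal} _); apply: val_inj => /=.
by rewrite (insubdK 0 yV) mulVf.
Qed.

Fact residue_inv0 : residue_inv 0 = 0.
Proof.
rewrite /residue_inv /residue; apply/eqP.
have : (repr (0 : residue_field)) \in max_ideal.
  rewrite -[repr _]subr0 Quotient.idealrBE reprK; apply/eqP.
  by rewrite rmorph0.
rewrite inE => /orP[/eqP -> | h].
  have -> : insubd (0 : vring_elt) (0^-1 : F) = 0.
    apply: val_inj; rewrite val_insubd invr0 /=; by case: ifP.
  by rewrite rmorph0.
by rewrite /insubd insubF ?rmorph0 //; apply/negbTE.
Qed.

HB.instance Definition _ :=
  GRing.ComNzRing_isField.Build residue_field residue_mulVf residue_inv0.

End ResidueField.

(* The map k_v -> k_w induced by f : K -> L; it is meaningful (independent of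
   the lift, and a field embedding) when W extends V along f. *)
Definition residue_map (K L : fieldType) (f : K -> L)
    (V : valuation_ring K) (W : valuation_ring L) :
    residue_field V -> residue_field W :=
  fun y => residue (insubd 0 (f (val (repr y)))).

Fact residue_mapE (K L : fieldType) (f : {rmorphism K -> L})
    (V : valuation_ring K) (W : valuation_ring L) (x : vring_elt V) :
  extends_ring f V W ->
  residue_map f W (residue x) = residue (insubd (0 : vring_elt W) (f (val x))).
Proof.
move=> fVW; rewrite /residue_map; set y := repr _.
have insE (z : vring_elt V) :
    val (insubd (0 : vring_elt W) (f (val z))) = f (val z).
  by rewrite val_insubd (fVW (val z)) (valP z).
have : y - x \in @max_ideal _ V by rewrite Quotient.idealrBE reprK.
rewrite inE /= => yx; apply/eqP; rewrite -Quotient.idealrBE inE /= !insE.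
by rewrite -rmorphB fmorph_eq0 -fmorphV fVW.
Qed.

Definition finite_degree (k l : fieldType) (f : k -> l) : Prop :=
  exists (n : nat) (b : 'I_n -> l), forall y : l,
    exists c : 'I_n -> k, y = \sum_(i < n) f (c i) * b i.

Definition algebraic_ext (k l : fieldType) (f : k -> l) : Prop :=
  forall u : l, algebraicOver f u.

Definition is_algebraic_closure (k l : fieldType) (f : k -> l) : Prop :=
  GRing.closed_field_axiom l /\ algebraic_ext f.

Definition perfect_field (k : fieldType) : Prop :=
  forall p : {poly k}, irreducible_poly p -> separable_poly p.

Definition algebraically_closed (k : fieldType) : Prop :=
  GRing.closed_field_axiom k.

(* Real closed as an abstract field: some ordering makes it an rcfType. *)
Definition real_closed_field (k : fieldType) : Prop :=
  exists (R : rcfType) (f : {rmorphism k -> R}), bijective f.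

Definition finite_field (k : fieldType) : Prop :=
  exists s : seq k, forall x, x \in s.

Definition number_field (k : fieldType) : Prop :=
  exists f : {rmorphism rat -> k}, finite_degree f.

Definition cauchy_seq (F : fieldType) (v : valuation F) (u : nat -> F) : Prop :=
  forall e : rat, exists N : nat, forall m n : nat,
    (N <= m)%N -> (N <= n)%N -> (e%:E <= v (u m - u n)%R)%E.

Definition converges_to (F : fieldType) (v : valuation F)
    (u : nat -> F) (l : F) : Prop :=
  forall e : rat, exists N : nat, forall n : nat,
    (N <= n)%N -> (e%:E <= v (u n - l)%R)%E.

(* In rank one, sequences suffice to express completeness. *)
Definition is_completion (F G : fieldType) (v : valuation F)
    (w : valuation G) (f : F -> G) : Prop :=
  [/\ extends_valuation f v w,
      forall (y : G) (e : rat), exists x : F, (e%:E <= w (y - f x)%R)%E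
    & forall u : nat -> G, cauchy_seq w u -> exists l, converges_to w u l].

Definition ratfun (K : fieldType) : fieldType := {fraction {poly K}}.

Definition ratfun_cst (K : fieldType) : {rmorphism K -> ratfun K} :=
  @tofrac {poly K} \o @polyC K.

(* phi(alpha), computed on the chosen representative of phi; meaningful when
   alpha is transcendental over K (no denominator vanishes at alpha). *)
Definition ratfun_eval (K C : fieldType) (f : {rmorphism K -> C}) (alpha : C)
    (phi : ratfun K) : C :=
  (map_poly f (\n_(repr phi))).[alpha] / (map_poly f (\d_(repr phi))).[alpha].

Fact ratfun_evalE (K C : fieldType) (f : {rmorphism K -> C}) (alpha : C)
    (p q : {poly K}) : ~ algebraicOver f alpha -> q != 0 ->
  ratfun_eval f alpha (tofrac p / tofrac q)
    = (map_poly f p).[alpha] / (map_poly f q).[alpha].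
Proof.
move=> tr q0; set phi : ratfun K := _ / _.
have ev0 (r : {poly K}) : r != 0 -> (map_poly f r).[alpha] != 0.
  by move=> r0; apply/negP => rr; apply: tr; exists r.
have d0 : \d_(repr phi) != 0 by exact: denom_ratioP.
have phiE : phi = tofrac \n_(repr phi) / tofrac \d_(repr phi).
  apply: (canRL (mulfK _)); first by rewrite tofrac_eq0.
  rewrite -[X in X * _]reprK; apply/eqP.
  by rewrite !piE /= FracField.equivfE /FracField.mulf
    !(numden_Ratio, oner_eq0, mulf_neq0) ?oner_eq0 ?mulr1 ?mul1r // mulrC.
rewrite /ratfun_eval; apply/eqP; rewrite eqr_div ?ev0 //.
move/eqP: phiE; rewrite eqr_div ?tofrac_eq0 // -!tofracM tofrac_eq => /eqP e.
by rewrite -!hornerM -!rmorphM /= -e mulrC.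
Qed.

Definition V_at (K C : fieldType) (f : {rmorphism K -> C}) (v : valuation C)
    (alpha : C) : {pred ratfun K} :=
  [pred phi | (0 <= v (ratfun_eval f alpha phi))%E].

(* Main.v *)
Require Import Defs.
From HB Require Import structures.
From mathcomp Require Import all_boot all_order all_algebra all_field.
From mathcomp Require Import constructive_ereal.
From mathcomp Require Import boolp complex.
From mathcomp Require Import ring lra.

Set Implicit Arguments.
Unset Strict Implicit.
Unset Printing Implicit Defensive.

Import Order.TTheory GRing.Theory Num.Theory.
Local Open Scope ring_scope.

(** Notation: k is the residue field of V, up a uniformizer of V, H the completion
    of K, L an algebraic closure of H and C the completion of L.

    From (1) to (2). The residue field R of L is algebraically closed and
    algebraic over k, and its degree over k is infinite. Starting from H, one builds a tower S 0, S 1, ... of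
    unramified subfields of L, each with residue field finite over k, by lifting
    at each step the minimal polynomial of a residue not yet obtained
    ([unramified_step]). This gives a n in S (n + 1), and alpha is the sum of the
    a n * up ^ n. The partial sums lie in unramified fields, so that K(alpha) has
    value group Z ([limit_order_int]). If alpha were algebraic over H, a Taylor
    expansion of its equation at a partial sum would show the residue of a n to
    come from S n for n large ([limit_not_algebraic]). In characteristic p the
    equation may be inseparable: alpha is then replaced by some alpha ^ q with q a
    power of p, and a n must be such that no q-th power of its residue lies in the
    residue field of S n. As k is perfect, any new residue is of that kind
    ([pth_root_closed]).

    From (2) to (3). Take W = V_alpha. An element of C is close to an element
    algebraic over H, hence residually algebraic ([integral_relation]). If k_w
    were finite over k, then W, being discrete, would be generated modulo up by
    finitely many elements ([residual_generators]), and by successive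
    approximation these would span K(alpha) over H ([complete_span]): alpha
    would be algebraic over H.

    From (3) to (1). An algebraic extension of a perfect field has at most the
    degree of the algebraic closure ([finite_closure]): by the primitive element
    theorem every finite part of it is k(z), and the minimal polynomial of z also
    has a root in the closure. The same lemma passes from the given algebraic
    closure of k to R.

    The description of the fields k with [kbar : k] finite is the theorem of
    Artin and Schreier. Suppose kbar = k(theta) finite over k, and let I be a
    square root of -1. A nontrivial automorphism of kbar over k fixing I would
    have a power rho of prime order p. If p is not the characteristic, rho has an
    eigenvector a with eigenvalue a primitive p-th root of unity, and the norm of
    a p-th root of a gives a contradiction ([prime_order_kummer]); otherwise
    x |-> x ^ p - x would be onto on the fixed field, so that no a could satisfy
    rho a = a + 1 ([prime_order_artin_schreier]). Hence kbar is k or k(I), and in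
    the second case the squares of k define a real closed order
    ([quadratic_closure_real_closed]). Finite fields are excluded because an
    algebraically closed field is infinite, and number fields because the
    polynomials X ^ n - 2 are irreducible over the rationals. *)

(** * Valuations as rational-valued orders *)

Section Ord.
Variables (F : fieldType) (w : valuation F).
Implicit Types (x y : F) (d e : rat).

(** The value of ord at 0 is arbitrary, which is why the two predicates below
    treat 0, of infinite value, apart. *)
Definition ord x : rat := fine (w x).
Definition vge e x := (x == 0) || (e <= ord x).
Definition vgt e x := (x == 0) || (e < ord x).

Lemma valE x : x != 0 -> w x = (ord x)%:E.
Proof. by move=> x0; rewrite fineK // val_fin. Qed.

Lemma vgeE e x : (e%:E <= w x)%E = vge e x.
Proof.
by rewrite /vge; have [->|x0] := eqVneq x 0; rewrite ?Defs.val0 ?leey // valE ?lee_fin.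
Qed.

Lemma ordM x y : x != 0 -> y != 0 -> ord (x * y) = ord x + ord y.
Proof.
move=> x0 y0; have := Defs.valM w x y; rewrite !valE ?mulf_neq0 //.
by rewrite -EFinD => -[].
Qed.

Lemma ord1 : ord 1 = 0.
Proof.
have := ordM (oner_neq0 F) (oner_neq0 F); rewrite mulr1 => h; lra.
Qed.

Lemma ordV x : x != 0 -> ord x^-1 = - ord x.
Proof.
move=> x0; have := ordM x0 (invr_neq0 x0); rewrite divff // ord1 => h; lra.
Qed.

Lemma ordX x n : x != 0 -> ord (x ^+ n) = ord x *+ n.
Proof.
move=> x0; elim: n => [|n IH]; first by rewrite expr0 ord1.
by rewrite exprS ordM ?expf_neq0 // IH mulrS.
Qed.

Lemma ordN x : ord (- x) = ord x.
Proof.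
have [->|x0] := eqVneq x 0; first by rewrite oppr0.
have n1 : (-1 : F) != 0 by rewrite oppr_eq0 oner_eq0.
have : ord (-1) + ord (-1) = 0 by rewrite -ordM // mulrNN mulr1 ord1.
by move=> h; rewrite -mulN1r ordM //; lra.
Qed.

Lemma vge0 e : vge e 0. Proof. by rewrite /vge eqxx. Qed.
Lemma vgt0 e : vgt e 0. Proof. by rewrite /vgt eqxx. Qed.
Hint Resolve vge0 vgt0 : core.

Lemma vge_ord x e : e <= ord x -> vge e x.
Proof. by move=> h; rewrite /vge h orbT. Qed.

Lemma vgt_ord x e : e < ord x -> vgt e x.
Proof. by move=> h; rewrite /vgt h orbT. Qed.

Lemma vge_le e d x : d <= e -> vge e x -> vge d x.
Proof. by move=> de; rewrite /vge => /orP[->//|h]; rewrite (le_trans de h) orbT. Qed.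

Lemma vgt_vge e x : vgt e x -> vge e x.
Proof. by rewrite /vgt /vge => /orP[->//|/ltW ->]; rewrite orbT. Qed.

Lemma vge_vgt d e x : d < e -> vge e x -> vgt d x.
Proof.
move=> de; rewrite /vge /vgt => /orP[->//|h].
by rewrite (lt_le_trans de h) orbT.
Qed.

Lemma vge_all x : (forall e, vge e x) -> x = 0.
Proof.
move=> h; apply/eqP; have /orP[//|h1] := h (ord x + 1); exfalso; lra.
Qed.

Lemma ordD x y : x != 0 -> y != 0 -> x + y != 0 ->
  Num.min (ord x) (ord y) <= ord (x + y).
Proof.
move=> x0 y0 xy0; have := Defs.valD w x y; rewrite !valE // !minEle lee_fin.
by case: ifP => _; rewrite lee_fin.
Qed.

Lemma vgeD e x y : vge e x -> vge e y -> vge e (x + y).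
Proof.
have [->|x0] := eqVneq x 0; first by rewrite add0r.
have [->|y0] := eqVneq y 0; first by rewrite addr0.
rewrite /vge (negbTE x0) (negbTE y0) /= => hx hy.
have [//|xy0] := eqVneq (x + y) 0; apply: le_trans (ordD x0 y0 xy0).
by rewrite le_min hx.
Qed.

Lemma vgtD e x y : vgt e x -> vgt e y -> vgt e (x + y).
Proof.
have [->|x0] := eqVneq x 0; first by rewrite add0r.
have [->|y0] := eqVneq y 0; first by rewrite addr0.
rewrite /vgt (negbTE x0) (negbTE y0) /= => hx hy.
have [//|xy0] := eqVneq (x + y) 0; apply: lt_le_trans (ordD x0 y0 xy0).
by rewrite lt_min hx.
Qed.

Lemma vgeN e x : vge e (- x) = vge e x.
Proof. by rewrite /vge oppr_eq0 ordN. Qed.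

Lemma vgtN e x : vgt e (- x) = vgt e x.
Proof. by rewrite /vgt oppr_eq0 ordN. Qed.

Lemma vgeB e x y : vge e x -> vge e y -> vge e (x - y).
Proof. by move=> hx hy; rewrite vgeD ?vgeN. Qed.

Lemma vgtB e x y : vgt e x -> vgt e y -> vgt e (x - y).
Proof. by move=> hx hy; rewrite vgtD ?vgtN. Qed.

Lemma vge_sum (I : Type) (r : seq I) (P : pred I) (G : I -> F) e :
  (forall i, P i -> vge e (G i)) -> vge e (\sum_(i <- r | P i) G i).
Proof. by move=> h; elim/big_ind: _ => //; apply: vgeD. Qed.

Lemma vgt_sum (I : Type) (r : seq I) (P : pred I) (G : I -> F) e :
  (forall i, P i -> vgt e (G i)) -> vgt e (\sum_(i <- r | P i) G i).
Proof. by move=> h; elim/big_ind: _ => //; apply: vgtD. Qed.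

Lemma vgeM d e x y : vge d x -> vge e y -> vge (d + e) (x * y).
Proof.
have [->|x0] := eqVneq x 0; first by rewrite mul0r.
have [->|y0] := eqVneq y 0; first by rewrite mulr0.
by rewrite /vge mulf_eq0 (negbTE x0) (negbTE y0) /= ordM // => ? ?; lra.
Qed.

Lemma vgtM d e x y : vgt d x -> vge e y -> vgt (d + e) (x * y).
Proof.
have [->|x0] := eqVneq x 0; first by rewrite mul0r.
have [->|y0] := eqVneq y 0; first by rewrite mulr0.
rewrite /vge /vgt mulf_eq0 (negbTE x0) (negbTE y0) /= ordM // => ? ?; lra.
Qed.

Lemma vge1 : vge 0 1. Proof. by rewrite vge_ord // ord1. Qed.

Lemma vgt1 : vgt 0 1 = false. Proof. by rewrite /vgt oner_eq0 ord1 ltxx. Qed.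

Lemma vgeM0 x y : vge 0 x -> vge 0 y -> vge 0 (x * y).
Proof. by move=> hx hy; rewrite -[0]addr0 vgeM. Qed.

Lemma vgtMl x y : vgt 0 x -> vge 0 y -> vgt 0 (x * y).
Proof. by move=> hx hy; rewrite -[0]addr0 vgtM. Qed.

Lemma vgtMr x y : vge 0 x -> vgt 0 y -> vgt 0 (x * y).
Proof. by move=> hx hy; rewrite mulrC vgtMl. Qed.

Lemma vgeX e x n : vge e x -> vge (e *+ n) (x ^+ n).
Proof.
by move=> hx; elim: n => [|n IH]; rewrite ?vge1 // exprS mulrS vgeM.
Qed.

Lemma vgeX0 x n : vge 0 x -> vge 0 (x ^+ n).
Proof. by move=> hx; have := vgeX n hx; rewrite mul0rn. Qed.

Lemma vgt_dom x y : x != 0 -> vgt (ord x) y -> x + y != 0 /\ ord (x + y) = ord x.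
Proof.
move=> x0; have [->|y0] := eqVneq y 0; first by rewrite addr0.
rewrite /vgt (negbTE y0) /= => lxy.
have xy0 : x + y != 0.
  by apply: contraTneq lxy => /addr0_eq <-; rewrite ordN ltxx.
split=> //; apply/eqP; rewrite eq_le; apply/andP; split; last first.
  apply: le_trans (ordD x0 y0 xy0); by rewrite le_min lexx ltW.
have := @ordD (x + y) (- y); rewrite addrK oppr_eq0 ordN.
by move/(_ xy0 y0 x0); rewrite ge_min => /orP[//|] ?; lra.
Qed.

Lemma vge_congr e x y : vge e (x - y) -> vge e x = vge e y.
Proof.
move=> h; apply/idP/idP => hx; last by rewrite -(subrK y x) vgeD.
by rewrite -(subKr x y) vgeB.
Qed.

Lemma vgt_congr e x y : vgt e (x - y) -> vgt e x = vgt e y.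
Proof.
move=> h; apply/idP/idP => hx; last by rewrite -(subrK y x) vgtD.
by rewrite -(subKr x y) vgtB.
Qed.

Lemma vgt_ge e x : x != 0 -> vge e x -> ~~ vgt e x -> ord x = e.
Proof.
by rewrite /vge /vgt => /negbTE -> /=; case: ltgtP => // ->.
Qed.

Lemma notvgt_neq0 e x : ~~ vgt e x -> x != 0.
Proof. by apply: contraNneq => ->. Qed.

Lemma unit_ord x : vge 0 x -> ~~ vgt 0 x -> x != 0 /\ ord x = 0.
Proof. by move=> h1 h2; have x0 := notvgt_neq0 h2; split=> //; apply: vgt_ge. Qed.

Lemma vge_horner (p : {poly F}) x :
  (forall i, vge 0 p`_i) -> vge 0 x -> vge 0 p.[x].
Proof.
move=> hp hx; rewrite horner_coef vge_sum // => i _.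
by rewrite vgeM0 // vgeX0.
Qed.

Lemma vgtXB x y n : vge 0 x -> vge 0 y -> vgt 0 (x - y) ->
  vgt 0 (x ^+ n - y ^+ n).
Proof.
move=> hx hy hxy; rewrite subrXX vgtMl // vge_sum // => i _.
by rewrite vgeM0 // vgeX0.
Qed.

Lemma vgt_horner (p : {poly F}) x y :
  (forall i, vge 0 p`_i) -> vge 0 x -> vge 0 y -> vgt 0 (x - y) ->
  vgt 0 (p.[x] - p.[y]).
Proof.
move=> hp hx hy hxy; rewrite !horner_coef -sumrB vgt_sum // => i _.
by rewrite -mulrBr vgtMr // vgtXB.
Qed.

Lemma horner_bound (p : {poly F}) :
  exists c, forall x, vge 0 x -> vge c p.[x].
Proof.
have [c hc] : exists c, forall i, vge c p`_i.
  elim/poly_ind: p => [|p a [c IH]]; first by exists 0 => i; rewrite coef0.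
  exists (Num.min c (ord a)) => i; rewrite coefD coefMX coefC.
  case: i => [|i] /=; first by rewrite add0r vge_ord // ge_min lexx orbT.
  by rewrite addr0 (vge_le _ (IH i)) // ge_min lexx.
exists c => x hx; rewrite horner_coef vge_sum // => i _.
by rewrite -[c]addr0 vgeM // vgeX0.
Qed.

(** The remainder involves the divided derivatives of order at least 2, which
    are bounded on the unit ball. *)
Lemma horner_taylor2 (p : {poly F}) :
  exists c, forall x h, vge 0 x -> vge 0 h -> exists2 r, vge c r &
    p.[x + h] = p.[x] + p^`().[x] * h + h ^+ 2 * r.
Proof.
have [c hc] : exists c, forall i x, (i < size p)%N -> vge 0 x ->
    vge c (p^`N(i)).[x].
  elim: {1}(size p) => [|n [c IH]]; first by exists 0.
  have [d hd] := horner_bound p^`N(n).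
  exists (Num.min c d) => i x; rewrite ltnS leq_eqVlt => /orP[/eqP -> hx|hi hx].
    by rewrite (vge_le _ (hd _ hx)) // ge_min lexx orbT.
  by rewrite (vge_le _ (IH _ _ hi hx)) // ge_min lexx.
have hdec (x h : F) m : exists r, \sum_(i < m.+2) (p^`N(i)).[x] * h ^+ i =
    p.[x] + p^`().[x] * h + h ^+ 2 * r /\
    r = \sum_(i < m) (p^`N(i.+2)).[x] * h ^+ i.
  eexists; split; last reflexivity.
  rewrite !big_ord_recl /= nderivn0 expr0 mulr1 nderivn1 expr1 addrA.
  congr (_ + _); rewrite mulr_sumr; apply: eq_bigr => i _.
  by rewrite /bump !leq0n !add1n [RHS]mulrCA -exprD.
exists c => x h hx hh.
have hp : p.[x + h] = \sum_(i < (size p).+2) (p^`N(i)).[x] * h ^+ i.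
  by apply: nderiv_taylor_wide; [exact: mulrC | rewrite -addn2 leq_addr].
have [r [hr re]] := hdec x h (size p).
exists r; last by rewrite hp hr.
rewrite re vge_sum // => i _; rewrite -[c]addr0 vgeM ?vgeX0 //.
have [lt|ge] := ltnP i.+2 (size p); first exact: hc.
by rewrite nderivn_poly0 ?horner0.
Qed.

End Ord.
Arguments vge_horner {F w p x}.

#[export] Hint Resolve vge0 vgt0 vge1 : core.

Lemma ord_ext (K L : fieldType) (f : K -> L) v w (x : K) :
  extends_valuation f v w -> ord w (f x) = ord v x.
Proof. by move=> h; rewrite /ord h. Qed.

Lemma vge_ext (K L : fieldType) (f : {rmorphism K -> L}) v w e (x : K) :
  extends_valuation f v w -> vge w e (f x) = vge v e x.
Proof. by move=> h; rewrite /vge fmorph_eq0 (ord_ext _ h). Qed.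

Lemma vgt_ext (K L : fieldType) (f : {rmorphism K -> L}) v w e (x : K) :
  extends_valuation f v w -> vgt w e (f x) = vgt v e x.
Proof. by move=> h; rewrite /vgt fmorph_eq0 (ord_ext _ h). Qed.

(** * Linear dependence and finite degree *)

Definition dependent (k l : fieldType) (f : k -> l) n (u : 'I_n -> l) : Prop :=
  exists a : 'I_n -> k, (exists i, a i != 0) /\ \sum_(i < n) f (a i) * u i = 0.

(** The matrix of coordinates has more rows than columns, hence a nonzero row
    kernel. *)
Lemma dependent_span (k l : fieldType) (f : {rmorphism k -> l}) (I : finType)
    (B : I -> l) n (u : 'I_n -> l) : (#|I| < n)%N ->
  (forall i, exists c : I -> k, u i = \sum_j f (c j) * B j) -> dependent f u.
Proof.
move=> ltIn /choice[c hc].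
pose M : 'M[k]_(n, #|I|) := \matrix_(i, j) c i (enum_val j).
have : kermx M != 0.
  rewrite kermx_eq0 /row_free; apply: contraTneq ltIn => <-.
  by rewrite -leqNgt rank_leq_col.
move/matrix0Pn => [i0 [i1 h]]; exists (fun i => kermx M i0 i); split.
  by exists i1.
have kM j : \sum_i kermx M i0 i * c i j = 0.
  have := mulmx_ker M => /matrixP/(_ i0 (enum_rank j)); rewrite !mxE => hM.
  by rewrite -[RHS]hM; apply: eq_bigr => i _; rewrite !mxE enum_rankK.
under eq_bigr => i _ do rewrite hc mulr_sumr.
rewrite exchange_big big1 //= => j _.
under eq_bigr => i _ do rewrite mulrA -rmorphM.
by rewrite -mulr_suml -rmorph_sum kM rmorph0 mul0r.
Qed.

Lemma finite_degree_dependent (k l : fieldType) (f : {rmorphism k -> l}) :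
  finite_degree f -> exists n, forall u : 'I_n -> l, dependent f u.
Proof.
move=> [n [b hb]]; exists n.+1 => u.
by apply: (@dependent_span _ _ _ _ b) => [|i]; rewrite ?card_ord //; apply: hb.
Qed.

(** A family that is independent and of the largest possible length spans. *)
Lemma dependent_finite_degree (k l : fieldType) (f : {rmorphism k -> l}) n :
  (forall u : 'I_n -> l, dependent f u) -> finite_degree f.
Proof.
move=> hn.
have : exists m, `[< forall u : 'I_m -> l, dependent f u >].
  by exists n; apply/asboolP.
case/ex_minnP => -[|m] /asboolP hm hmin.
  by case: (hm (fun _ => 0)) => a [[[]]].
have /existsNP[u nu] : ~ forall u : 'I_m -> l, dependent f u.
  by move=> /asboolP/hmin; rewrite ltnn.
exists m, u => y.
pose u' (i : 'I_m.+1) := if unlift ord0 i is Some j then u j else y.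
have [a [[i0 ai0]]] := hm u'; rewrite big_ord_recl /u' unlift_none.
under eq_bigr => i _ do rewrite liftK.
have [a0|a0] := eqVneq (a ord0) 0.
  rewrite a0 rmorph0 mul0r add0r => s0; case: nu.
  exists (fun i => a (lift ord0 i)); split=> //.
  by case: (unliftP ord0 i0) ai0 => [j ->|->]; [exists j | rewrite a0 eqxx].
move=> /eqP; rewrite addr_eq0 => /eqP h.
exists (fun i => - (a ord0)^-1 * a (lift ord0 i)).
have fa0 : f (a ord0) != 0 by rewrite fmorph_eq0.
apply: (mulfI fa0); rewrite h mulr_sumr -sumrN; apply: eq_bigr => i _.
by rewrite rmorphM rmorphN fmorphV mulrA mulrA mulrN divff // mulN1r mulNr.
Qed.

Lemma dependent_powers (k l : fieldType) (f : {rmorphism k -> l}) n (y : l) :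
  dependent f (fun i : 'I_n => y ^+ i) ->
  exists p : {poly k}, [/\ p != 0, (size p <= n)%N & root (map_poly f p) y].
Proof.
move=> [a [[i0 ai0] h]]; pose a' i := oapp a 0 (insub i : option 'I_n).
exists (\poly_(i < n) a' i); split; last 2 first.
- exact: size_poly.
- rewrite rootE (@horner_coef_wide _ n) ?size_map_poly ?size_poly //.
  rewrite -[eqbRHS]h; apply/eqP; apply: eq_bigr => i _.
  by rewrite coef_map coef_poly ltn_ord /a' valK.
apply: contraNneq ai0 => /polyP/(_ i0).
by rewrite coef_poly ltn_ord coef0 /a' valK /= => ->.
Qed.

(** The minimal polynomial of an algebraic element, as a nonzero annihilator of
    least degree. *)
Lemma algebraic_min (k l : fieldType) (f : {rmorphism k -> l}) (y : l) :
  algebraicOver f y -> exists p : {poly k}, [/\ irreducible_poly p,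
    root (map_poly f p) y & forall q, root (map_poly f q) y -> p %| q].
Proof.
move=> [p0 p0n0 rp0].
have : exists n, `[< exists p : {poly k},
    [/\ p != 0, size p = n & root (map_poly f p) y] >].
  by exists (size p0); apply/asboolP; exists p0.
case/ex_minnP => n /asboolP[p [p0' sp rp]] hmin.
have pdiv q : root (map_poly f q) y -> p %| q.
  move=> rq; rewrite /dvdp; apply/negPn/negP => r0.
  have : root (map_poly f (q %% p)) y.
    rewrite (divp_eq q p) rmorphD rmorphM rootE hornerD hornerM in rq.
    by rewrite rootE; move: rq; rewrite (eqP rp) mulr0 add0r.
  move=> rr; have : (n <= size (q %% p)%R)%N.
    by apply: hmin; apply/asboolP; exists (q %% p); split=> //; rewrite size_poly_eq0.
  by rewrite leqNgt -sp ltn_modp p0'.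
exists p; split=> //; split.
  have := @root_size_gt1 _ y (map_poly f p).
  by rewrite map_poly_eq0 size_map_poly; apply.
move=> q sq qp; have /dvdpP[r pqr] := qp.
have q0 : q != 0 by apply: contraNneq p0' => q0; rewrite pqr q0 mulr0.
have r0 : r != 0 by apply: contraNneq p0' => r0; rewrite pqr r0 mul0r.
rewrite /eqp qp /=; move: (rp); rewrite {1}pqr rmorphM rootM => /orP[]; last exact: pdiv.
move/pdiv/(dvdp_leq r0); rewrite pqr size_mul // -subn1 leqNgt => /negP[].
have : (1 < size q)%N by rewrite ltn_neqAle eq_sym sq size_poly_gt0.
by case: (size q) => [|[|m]] // _; rewrite !addnS subn1 /= ltnS leq_addr.
Qed.

Lemma size2_root (k l : fieldType) (f : {rmorphism k -> l}) (m : {poly k}) w :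
  size m = 2 -> root (map_poly f m) w -> w = f (- m`_0 / m`_1).
Proof.
move=> sm; have m1n : m`_1 != 0.
  by have := lead_coef_eq0 m; rewrite /lead_coef sm /= => ->; rewrite -size_poly_eq0 sm.
rewrite rootE (@horner_coef_wide _ 2) ?size_map_poly ?sm //.
rewrite big_ord_recl big_ord1 /= !coef_map expr0 mulr1 /bump /= expr1.
rewrite addrC addr_eq0 => /eqP h.
by rewrite rmorphM fmorphV rmorphN -h mulrAC divff ?mul1r // fmorph_eq0.
Qed.

(** * Algebraically closed fields *)

Section Closed.
Variables (l : fieldType) (lC : GRing.closed_field_axiom l).

Lemma closed_has_root (p : {poly l}) : size p != 1 -> exists x, root p x.
Proof. by move/(PreClosedField.closed_rootP lC). Qed.

Lemma closed_split (p : {poly l}) : p \is monic ->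
  exists s : seq l, p = \prod_(z <- s) ('X - z%:P).
Proof.
move: {2}(size p) (leqnn (size p)) => n.
elim: n p => [|n IH] p.
  by rewrite leqn0 size_poly_eq0 => /eqP -> /monic_neq0; rewrite eqxx.
move=> sp mp; have [/eqP sp1|/closed_has_root[x]] := boolP (size p == 1).
  have /size_poly1P[c _ e] := introT eqP sp1.
  by exists [::]; move: mp; rewrite big_nil e monicE lead_coefC => /eqP ->.
move=> /factor_theorem[q pq].
have mq : q \is monic by move: mp; rewrite pq monicMr ?monicXsubC.
have [|s qs] := IH q _ mq.
  move: sp; rewrite pq size_Mmonic ?monicXsubC ?monic_neq0 // size_XsubC.
  by rewrite addn2.
by exists (x :: s); rewrite big_cons mulrC -qs.
Qed.

(** An annihilator over an algebraically closed field has all its roots there. *)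
Lemma closed_sub (m : fieldType) (g : {rmorphism l -> m}) y :
  algebraicOver g y -> exists x, y = g x.
Proof.
move=> [p p0]; have [|s ps] := @closed_split ((lead_coef p)^-1 *: p).
  by rewrite monicE lead_coefZ mulVf // lead_coef_eq0.
move=> ry0; have : root (map_poly g ((lead_coef p)^-1 *: p)) y.
  by rewrite map_polyZ rootZ // fmorph_eq0 invr_eq0 lead_coef_eq0.
rewrite ps rmorph_prod => ry.
have : root (\prod_(z <- map g s) ('X - z%:P)) y.
  rewrite big_map; move: ry; rewrite (eq_bigr (fun z => 'X - (g z)%:P)) // => z _.
  by rewrite rmorphB /= map_polyX map_polyC.
by rewrite root_prod_XsubC => /mapP[x _ ->]; exists x.
Qed.

Lemma closed_infinite (s : seq l) : exists x, x \notin s.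
Proof.
have [x] := PreClosedField.closed_nonrootP lC (\prod_(z <- s) ('X - z%:P))
  (monic_neq0 (monic_prod_XsubC _ _ _)).
by rewrite root_prod_XsubC; exists x.
Qed.

End Closed.

Lemma closed_rootX (l : fieldType) (lC : GRing.closed_field_axiom l) n (a : l) :
  (0 < n)%N -> exists b, b ^+ n = a.
Proof.
move=> n0; have [b hb] := lC n (fun i => if i == 0%N then a else 0) n0.
exists b; rewrite hb (bigD1 (Ordinal n0)) //= mulr1 big1 ?addr0 // => i hi.
by rewrite -val_eqE in hi; rewrite (negbTE hi) mul0r.
Qed.

Definition infinite_field (k : fieldType) := forall s : seq k, exists x, x \notin s.

(** A finite extension of a finite field is finite, hence not algebraically
    closed. *)
Lemma base_infinite (k l : fieldType) (f : {rmorphism k -> l}) :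
  GRing.closed_field_axiom l -> finite_degree f -> infinite_field k.
Proof.
move=> lC [n [b hb]] s; apply: contrapT => /forallNP hs.
have {}hs x : x \in s by apply/negPn/negP/hs.
pose g (c : {ffun 'I_n -> seq_sub s}) := \sum_(i < n) f (val (c i)) * b i.
have [y /negP[]] := closed_infinite lC (codom g).
have [c ->] := hb y; apply/codomP.
exists [ffun i => SeqSub (hs (c i))]; apply: eq_bigr => i _.
by rewrite ffunE.
Qed.

Lemma infinite_nonroot (k l : fieldType) (f : {rmorphism k -> l}) (r : {poly l}) :
  infinite_field k -> r != 0 -> exists t, ~~ root r (f t).
Proof.
move=> ik r0; apply: contrapT => /forallNP h.
have {}h t : root r (f t) by apply/negPn/negP/h.
have [s us ss] : exists2 s : seq k, uniq s & size s = size r.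
  elim: (size r) => [|n [s us <-]]; first by exists [::].
  by have [x xs] := ik s; exists (x :: s); rewrite /= ?xs.
have rs : all (root r) (map f s) by apply/allP => _ /mapP[x _ ->].
have us' : uniq (map f s) by rewrite (map_inj_uniq (fmorph_inj f)).
by have := max_poly_roots r0 rs us'; rewrite size_map ss ltnn.
Qed.

(** * Primitive elements over a perfect field *)

Section Perfect.
Variables (k : fieldType) (perf : perfect_field k).

Lemma perfect_sep (l : fieldType) (f : {rmorphism k -> l}) (y : l) :
  algebraicOver f y ->
  exists p : {poly k}, [/\ irreducible_poly p, separable_poly p,
    root (map_poly f p) y & forall q, root (map_poly f q) y -> p %| q].
Proof.
by move=> /algebraic_min[p [ip rp pq]]; exists p; split=> //; apply: perf.
Qed.

(** The elements are absorbed one at a time by the two-generator theorem; the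
    field k has a parameter t outside the finite exceptional set because it is
    infinite. *)
Lemma primitive_element (m : fieldType) (j : {rmorphism k -> m}) n (u : 'I_n -> m) :
  infinite_field k -> algebraic_ext j ->
  exists z, forall i, exists q, (map_poly j q).[z] = u i.
Proof.
move=> ik ja; elim: n u => [|n IH] u; first by exists 0 => -[].
have [z hz] := IH (fun i => u (lift ord0 i)).
have [p p0 rp] := ja z; have [q [_ sq rq _]] := perfect_sep (ja (u ord0)).
have [r r0 hr] := large_field_PET p0 rp rq sq.
have [t /hr[]] := infinite_nonroot j ik r0; set w := _ - _.
move=> [a ha] [b hb]; exists w => i; case: (unliftP ord0 i) => [i' ->|->].
  by have [c hc] := hz i'; exists (c \Po a); rewrite map_comp_poly horner_comp ha.
by exists b.
Qed.

(** The degree of an algebraic extension of a perfect field is at most that of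
    its algebraic closure: a finitely generated piece k(z) has for degree that of
    the minimal polynomial of z, which also has a root in the closure.  This
    compares the two extensions without embedding one in the other. *)
Lemma finite_closure (l m : fieldType) (f : {rmorphism k -> l})
    (j : {rmorphism k -> m}) :
  GRing.closed_field_axiom l -> finite_degree f -> algebraic_ext j ->
  finite_degree j.
Proof.
move=> lC ff ja; have ik := base_infinite lC ff.
have [n hn] := finite_degree_dependent ff.
have sz (p : {poly k}) : irreducible_poly p -> (size p <= n)%N.
  move=> [sp ip]; have [|z rz] := closed_has_root lC (p := map_poly f p).
    by rewrite size_map_poly neq_ltn sp orbT.
  have [q [q0 sq rq]] := dependent_powers (hn (fun i => z ^+ i)).
  apply: leq_trans sq; apply: dvdp_leq => //.
  have : ~~ coprimep p q.
    rewrite -(coprimep_map f); apply/negP => /coprimep_root/(_ rz).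
    by rewrite -rootE rq.
  rewrite /coprimep => /ip/(_ (dvdp_gcdl _ _)) e.
  by rewrite -(eqp_dvdl _ e) dvdp_gcdr.
apply: (@dependent_finite_degree _ _ _ n) => u.
have [z hz] := primitive_element u ik ja.
have [p [ip _ rp _]] := perfect_sep (ja z).
have p0 : p != 0 by apply: irredp_neq0.
apply: (@dependent_span _ _ _ 'I_(size p).-1 (fun i => z ^+ i)).
  by rewrite card_ord prednK ?size_poly_gt0 // sz.
move=> i; have [q <-] := hz i; exists (fun a : 'I_(size p).-1 => (q %% p)`_a).
rewrite {1}(divp_eq q p) rmorphD rmorphM hornerD hornerM (eqP rp) mulr0 add0r.
rewrite (@horner_coef_wide _ (size p).-1); last first.
  by rewrite size_map_poly -ltnS prednK ?size_poly_gt0 // ltn_modp.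
by apply: eq_bigr => a _; rewrite coef_map.
Qed.

End Perfect.

(** * Automorphisms of prime order of an algebraically closed field *)

Lemma pcharB (R : comNzRingType) p (x y : R) : p \in [pchar R] ->
  (x - y) ^+ p = x ^+ p - y ^+ p.
Proof.
by move=> cp; have := pFrobenius_autB_comm cp (mulrC x y); rewrite !pFrobenius_autE.
Qed.

Section PrimeOrder.
Variables (L : fieldType) (lC : GRing.closed_field_axiom L).
Variables (rho : {rmorphism L -> L}) (p : nat) (pr_p : prime p).
Hypothesis rho_p : forall y, iter p rho y = y.

Let p_gt0 := prime_gt0 pr_p.

Lemma iter_rmM n x y : iter n rho (x * y) = iter n rho x * iter n rho y.
Proof. by elim: n => //= n ->; rewrite rmorphM. Qed.

Lemma iter_rmB n x y : iter n rho (x - y) = iter n rho x - iter n rho y.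
Proof. by elim: n => //= n ->; rewrite rmorphB. Qed.

Lemma prime_primitive (z : L) : z ^+ p = 1 -> z != 1 -> p.-primitive_root z.
Proof.
move=> zp z1; have [m pm mdp] := prim_order_exists p_gt0 zp.
have /primeP[_ /(_ _ mdp)/orP[/eqP m1|/eqP <- //]] := pr_p.
by move: (prim_expr_order pm) z1; rewrite m1 expr1 => ->; rewrite eqxx.
Qed.

(** On the p-th roots of unity rho is some power map mu |-> mu ^+ m. As its order
    divides p, m ^ p = 1 modulo p, and m = 1 modulo p by Fermat's little theorem. *)
Lemma fix_unity_root mu : mu ^+ p = 1 -> rho mu = mu.
Proof.
move=> mup; have [->|mu1] := eqVneq mu 1; first exact: rmorph1.
have pm := prime_primitive mup mu1.
have rmup : rho mu ^+ p = 1 by rewrite -rmorphXn mup rmorph1.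
have [[m' _] /= e] := prim_rootP pm rmup.
have it n : iter n rho mu = mu ^+ (m' ^ n).
  elim: n => [|n IH] /=; first by rewrite expn0 expr1.
  by rewrite IH rmorphXn e -exprM expnS.
have := rho_p mu; rewrite it -{2}[mu]expr1 => /eqP.
rewrite (eq_prim_root_expr pm) => /eqP h.
rewrite e -[RHS]expr1; apply/eqP; rewrite (eq_prim_root_expr pm); apply/eqP.
by rewrite -h fermat_little.
Qed.

(** The vector a is a Lagrange resolvent: an eigenvector of rho for the primitive
    p-th root of unity om^-1. *)
Lemma resolvent : p%:R != 0 :> L -> ~ rho =1 id ->
  exists om a, [/\ om ^+ p = 1, om != 1, a != 0 & om * rho a = a].
Proof.
move=> pn0 nid.
have p1 : (p != 1)%N by case: eqP pr_p => [->|].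
have [|z] := closed_has_root lC (p := \poly_(i < p) 1).
  by rewrite size_poly_eq ?oner_eq0.
rewrite rootE horner_poly; under eq_bigr do rewrite mul1r; move=> /eqP hz.
have z1 : z != 1.
  apply: contraNneq pn0 => z1; move: hz; rewrite z1.
  by under eq_bigr do rewrite expr1n; rewrite sumr_const card_ord => ->.
have zp : z ^+ p = 1 by apply/eqP; rewrite -subr_eq0 subrX1 hz mulr0.
have rz := fix_unity_root zp; have pz := prime_primitive zp z1.
(* If the resolvents R j vanish for 0 < j < p, their sum p * c equals R 0 c,
   which is fixed by rho. *)
pose R j c := \sum_(i < p) (z ^+ j) ^+ i * iter i rho c.
have hR j c : z ^+ j * rho (R j c) = R j c.
  have zjp : (z ^+ j) ^+ p = 1 by rewrite exprAC zp expr1n.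
  rewrite /R rmorph_sum mulr_sumr -(prednK p_gt0) big_ord_recr [RHS]big_ord_recl /=.
  rewrite addrC expr0 mul1r; congr (_ + _).
    rewrite rmorphM !rmorphXn rz mulrA -exprS prednK // zjp mul1r.
    by have := rho_p c; rewrite -{1}(prednK p_gt0).
  by apply: eq_bigr => i _; rewrite rmorphM !rmorphXn rz mulrA -exprS.
have [c [j [hj Rn0]]] : exists c j, (0 < j < p)%N /\ R j c != 0.
  apply: contrapT => /forallNP h; apply: nid => c /=.
  have {}h j : (0 < j < p)%N -> R j c = 0.
    by move=> hj; apply: contrapT => /eqP hn; apply: (h c); exists j.
  have S0 : \sum_(j < p) R j c = p%:R * c.
    rewrite /R exchange_big (bigD1 (Ordinal p_gt0)) //= [X in _ + X]big1.
      under eq_bigr do rewrite expr0 mul1r.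
      by rewrite addr0 sumr_const card_ord mulr_natl.
    move=> i; rewrite -val_eqE /= -lt0n => i0; rewrite -mulr_suml.
    suff -> : \sum_(j < p) (z ^+ j) ^+ i = 0 by rewrite mul0r.
    have : (z ^+ i - 1) * \sum_(j < p) (z ^+ i) ^+ j = 0.
      by rewrite -subrX1 exprAC zp expr1n subrr.
    move/eqP; rewrite mulf_eq0 subr_eq0 => /orP[/eqP zi|/eqP zi]; last first.
      by rewrite -[RHS]zi; apply: eq_bigr => j _; rewrite exprAC.
    have : (p %| i)%N by rewrite (prim_order_dvd pz) zi.
    by move/(dvdn_leq i0); rewrite leqNgt ltn_ord.
  have S1 : \sum_(j < p) R j c = R 0 c.
    rewrite (bigD1 (Ordinal p_gt0)) //= big1 ?addr0 // => j.
    by rewrite -val_eqE /= -lt0n => j0; apply: h; rewrite j0 ltn_ord.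
  have := hR 0%N c; rewrite expr0 mul1r -S1 S0 rmorphM rmorph_nat.
  exact: mulfI.
exists (z ^+ j), (R j c); split=> //; first by rewrite exprAC zp expr1n.
apply/eqP => zj; case/andP: hj => j0; have : (p %| j)%N by rewrite (prim_order_dvd pz) zj.
by move/(dvdn_leq j0); rewrite leqNgt => /negP.
Qed.

Variable I : L.
Hypotheses (I2 : I ^+ 2 = -1) (rhoI : rho I = I).

(** Kummer: the norm of a p-th root b of the eigenvector a is, up to a p-th root
    of 1 or of -1, the vector a itself, which would thus be fixed by rho. *)
Lemma prime_order_kummer : p%:R != 0 :> L -> rho =1 id.
Proof.
move=> pn0; apply: contrapT => /(resolvent pn0)[om [a [omp om1 a0 ha]]].
have rom := fix_unity_root omp.
have [b hb] := closed_rootX lC a p_gt0.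
pose N x := \prod_(i < p) iter i rho x.
have rN x : rho (N x) = N x.
  rewrite /N rmorph_prod -(prednK p_gt0) big_ord_recr [RHS]big_ord_recl /=.
  rewrite mulrC; congr (_ * _).
  by have := rho_p x; rewrite -{1}(prednK p_gt0).
have NX x n : N (x ^+ n) = N x ^+ n.
  rewrite /N -prodrXl; apply: eq_bigr => i _.
  by elim: n => [|n IH]; rewrite ?expr0 ?exprS ?iter_rmM -?IH //;
    elim: (val i) => //= j ->; rewrite rmorph1.
have ai i : om ^+ i * iter i rho a = a.
  elim: i => [|i IH]; first by rewrite expr0 mul1r.
  rewrite -[RHS]ha -[in RHS]IH /= rmorphM rmorphXn rom exprS mulrA.
  by rewrite [om * _]mulrC.
have h1 : om ^+ 'C(p, 2) * N b ^+ p = a ^+ p.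
  rewrite -NX hb -bin2_sum big_mkord expr_sum -big_split /=.
  rewrite -[X in a ^+ X]card_ord -prodr_const.
  by apply: eq_bigr => i _; rewrite ai.
have Nb0 : N b != 0.
  apply: contraNneq a0 => e; move: h1.
  by rewrite e expr0n eqn0Ngt p_gt0 mulr0 => /esym/eqP; rewrite expf_eq0 p_gt0.
pose mu := a / N b.
have mup : mu ^+ p = om ^+ 'C(p, 2).
  by rewrite /mu expr_div_n -h1 mulfK // expf_neq0.
(* The exponent 'C(p, 2) is a multiple of p for p odd; for p = 2 it is 1 and
   mu is a square root of om = -1, that is I or - I. *)
have rmu : rho mu = mu.
  have [p2|p2] := eqVneq p 2; last first.
    apply: fix_unity_root; rewrite mup.
    have /dvdnP[k ->] : (p %| 'C(p, 2))%N.
      by rewrite prime_dvd_bin //= ltn_neqAle eq_sym p2 prime_gt1.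
    by rewrite mulnC exprM omp expr1n.
  have : mu ^+ 2 = I ^+ 2.
    move: mup omp; rewrite p2 I2 => -> /eqP; rewrite sqrf_eq1 (negbTE om1) /=.
    by move/eqP ->; rewrite expr1.
  by move/eqP; rewrite eqf_sqr => /orP[] /eqP ->; rewrite ?rmorphN rhoI.
have ra : rho a = a by rewrite -(divfK Nb0 a) rmorphM rN -/mu rmu.
by move: ha om1; rewrite ra -{2}[a]mul1r => /(mulIf a0) ->; rewrite eqxx.
Qed.

Let D y := rho y - y.

(** P(rho) y, where the coefficients of P need not be fixed by rho; hence the
    product rule below only for a right factor 'X - 1. *)
Definition rho_act (P : {poly L}) y := \sum_(i < size P) P`_i * iter i rho y.

Lemma rho_act_wide n (P : {poly L}) y : (size P <= n)%N ->
  rho_act P y = \sum_(i < n) P`_i * iter i rho y.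
Proof.
move=> sn; rewrite /rho_act (big_ord_widen n (fun i => P`_i * iter i rho y)) //.
rewrite big_mkcond; apply: eq_bigr => i _; case: ltnP => // ge.
by rewrite nth_default ?mul0r.
Qed.

Lemma rho_actD (P : {poly L}) y : rho_act (P * ('X - 1)) y = rho_act P (D y).
Proof.
have sP : (size (P * ('X - 1))%R <= (size P).+1)%N.
  by rewrite -polyC1 (leq_trans (size_polyMleq _ _)) // size_XsubC addn2.
rewrite (@rho_act_wide _ _ y sP) (@rho_act_wide _ _ (D y) (leqnSn (size P))).
under [RHS]eq_bigr do rewrite /D iter_rmB mulrBr -iterSr.
rewrite sumrB mulrBr mulr1; under eq_bigr do rewrite coefB mulrBl.
rewrite sumrB; congr (_ - _).
rewrite big_ord_recl coefMX mul0r add0r [RHS]big_ord_recr /=.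
rewrite nth_default // mul0r addr0; apply: eq_bigr => i _.
by rewrite coefMX /=.
Qed.

Lemma rho_act_iter n y : iter n D y = rho_act (('X - 1) ^+ n) y.
Proof.
elim: n y => [|n IH] y.
  by rewrite expr0 /rho_act size_poly1 big_ord1 coef1 mul1r.
by rewrite iterSr IH exprSr rho_actD.
Qed.

(** Artin and Schreier: in characteristic p the operator D = rho - 1 is
    nilpotent, which gives some a with rho a = a + 1, and its last nonzero power
    maps onto the fixed field.  As x |-> x ^+ p - x is onto and commutes with D,
    it is also onto on the fixed field, whence a is in it up to an element of the
    prime field. *)
Lemma prime_order_artin_schreier : p \in [pchar L] -> rho =1 id.
Proof.
move=> cp; apply: contrapT => nid.
have rD x y : D (x - y) = D x - D y.
  by rewrite /D rmorphB; ring.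
have DM f x : rho f = f -> D (f * x) = f * D x.
  by move=> hf; rewrite /D rmorphM hf mulrBr.
have iD0 n : iter n D 0 = 0.
  by elim: n => //= n ->; rewrite /D rmorph0 subrr.
have iDM n f x : rho f = f -> iter n D (f * x) = f * iter n D x.
  by move=> hf; elim: n => //= n ->; rewrite DM.
have Dp : forall y, iter p D y = 0.
  move=> y; rewrite rho_act_iter.
  have -> : ('X - 1 : {poly L}) ^+ p = 'X^p - 1.
    by rewrite pcharB ?expr1n // pchar_poly.
  rewrite (@rho_act_wide p.+1) ?size_XnsubC //.
  have := p_gt0; case: p rho_p => [//|n] rn _; rewrite big_ord_recr big_ord_recl /=.
  rewrite !coefB !coefXn !coefC eqxx /= sub0r subr0 mul1r mulN1r.
  have := rn y; rewrite iterS => ->; rewrite big1 ?addr0 ?addNr // => i _.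
  by rewrite coefB coefXn coefC /bump /= add1n eqSS ltn_eqF // subrr mul0r.
have : exists n, `[< forall y, iter n D y = 0 >] by exists p; apply/asboolP.
case/ex_minnP => -[|[|n]] /asboolP hn hmin.
- by have := hn 1; move/eqP; rewrite oner_eq0.
- by case: nid => y; apply/eqP; rewrite -subr_eq0; apply/eqP/hn.
have /existsNP[c /eqP c0] : ~ forall y, iter n.+1 D y = 0.
  by move=> /asboolP/hmin; rewrite ltnn.
pose e0 := iter n.+1 D c.
have fixE y : rho (iter n.+1 D y) = iter n.+1 D y.
  by apply/eqP; rewrite -subr_eq0; apply/eqP/(hn y).
pose a := iter n D c / e0.
have ra : rho a = a + 1.
  rewrite /a rmorphM fmorphV fixE -[1](divff c0) -mulrDl; congr (_ / _).
  by rewrite /e0 [in RHS]iterS /D addrC subrK.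
pose wp (x : L) := x ^+ p - x.
have wpB x y : wp (x - y) = wp x - wp y.
  by rewrite /wp pcharB //; ring.
have wpD x : D (wp x) = wp (D x).
  by rewrite /D wpB /wp rmorphB rmorphXn.
have wpE m x : iter m D (wp x) = wp (iter m D x).
  by elim: m => //= m ->; apply: wpD.
have rwa : rho (wp a) = wp a.
  rewrite /wp rmorphB rmorphXn ra; have := pcharB (a + 1) 1 cp.
  by rewrite addrK expr1n => ->; ring.
have [x hx] := lC (fun i => if i == 0%N then wp a * c / e0 else (i == 1%N)%:R)
  p_gt0.
have {}hx : wp x = wp a * c / e0.
  have p1 := prime_gt1 pr_p.
  rewrite /wp hx (bigD1 (Ordinal p_gt0)) //= mulr1 (bigD1 (Ordinal p1)) //=.
  rewrite mul1r expr1 big1 ?addr0 ?addrK // => -[[|[|i]]] hi //= _.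
  by rewrite mul0r.
pose e := a - iter n.+1 D x.
have we : wp e = 0.
  rewrite /e wpB -wpE hx mulrAC iDM ?divfK ?subrr //.
  by rewrite rmorphM fmorphV rwa fixE.
have re : rho e = e + 1 by rewrite /e rmorphB fixE ra addrAC.
(* The p + 1 elements e, 0, 1, ..., p - 1 cannot all be distinct roots of
   'X^p - 'X. *)
have [m em] : exists m : nat, e = m%:R.
  apply: contrapT => /forallNP hm.
  pose s := e :: [seq i%:R | i <- iota 0 p].
  have q0 : ('X^p - 'X : {poly L}) != 0.
    rewrite -size_poly_eq0 size_polyDl ?size_polyXn ?size_polyN ?size_polyX //.
    by rewrite ltnS prime_gt1.
  have us : uniq s.
    rewrite /= map_inj_in_uniq ?iota_uniq ?andbT; last first.
      move=> i j; rewrite !mem_iota /= !add0n => hi hj.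
      wlog ij : i j hi hj / (i <= j)%N.
        move=> H hij; have [ij|/ltnW ji] := leqP i j; first exact: H.
        by apply/esym/H.
      move=> hij; apply/eqP; rewrite eqn_leq ij /= -subn_eq0 -leqn0 leqNgt.
      apply/negP => h0; have : (p %| j - i)%N.
        by rewrite (dvdn_pcharf cp) natrB // hij subrr.
      by move/(dvdn_leq h0); rewrite leqNgt (leq_ltn_trans (leq_subr _ _)).
    by apply/mapP => -[i _ /hm].
  have rs : all (root ('X^p - 'X)) s.
    apply/allP => y; rewrite inE rootE !hornerE => /orP[/eqP ->|].
      by rewrite -/(wp e) we.
    case/mapP => i _ ->; have := pFrobenius_aut_nat cp i.
    by rewrite pFrobenius_autE => ->; rewrite subrr.
  have := max_poly_roots q0 rs us.
  rewrite size_polyDl ?size_polyXn ?size_polyN ?size_polyX ?ltnS ?prime_gt1 //.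
  by rewrite /= size_map size_iota ltnn.
move: re; rewrite em rmorph_nat -{1}[m%:R]addr0 => /addrI/esym/eqP.
by rewrite oner_eq0.
Qed.

Lemma prime_order_fix_sqrtN1 : rho =1 id.
Proof.
have [p0|p0] := eqVneq (p%:R : L) 0; last exact: prime_order_kummer.
by apply: prime_order_artin_schreier; rewrite inE pr_p p0 eqxx.
Qed.
End PrimeOrder.

(** * The Artin-Schreier theorem over a perfect field *)

Lemma rmorphism_of (A B : nzRingType) (g : A -> B) :
  (forall x y, g (x - y) = g x - g y) -> g 1 = 1 ->
  (forall x y, g (x * y) = g x * g y) -> exists h : {rmorphism A -> B}, h =1 g.
Proof.
move=> gB g1 gM; have gM' : monoid_morphism g by split.
pose h : {rmorphism A -> B} := HB.pack g
  (GRing.isZmodMorphism.Build A B g gB) (GRing.isMonoidMorphism.Build A B g gM').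
by exists h.
Qed.

Lemma iter_rmorphism (A : nzRingType) (s : {rmorphism A -> A}) n :
  exists h : {rmorphism A -> A}, h =1 iter n s.
Proof.
elim: n => [|n [h hh]]; first by exists idfun.
by exists (s \o h) => x /=; rewrite hh.
Qed.

Section ArtinSchreier.
Variables (k L : fieldType) (f : {rmorphism k -> L}).
Hypotheses (perf : perfect_field k) (lC : GRing.closed_field_axiom L).
Hypotheses (falg : algebraic_ext f) (ff : finite_degree f).

Lemma primitive_generator :
  exists th, forall y, exists q, (map_poly f q).[th] = y.
Proof.
have [n [b hb]] := ff.
have [z hz] := primitive_element perf b (base_infinite lC ff) falg.
exists z => y; have [c ->] := hb y.
have /choice[q hq] := hz; exists (\sum_i c i *: q i).
rewrite rmorph_sum horner_sum; apply: eq_bigr => i _.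
by rewrite /= map_polyZ hornerZ hq.
Qed.

Section Generator.
Variables (th : L) (g : {poly k}).
Hypothesis thP : forall y, exists q, (map_poly f q).[th] = y.
Hypothesis gr : root (map_poly f g) th.
Hypothesis gdiv : forall q, root (map_poly f q) th -> g %| q.

(** As th generates L, evaluation at th' instead of th is well defined, the
    annihilator of th being generated by g. *)
Lemma conjugate_morphism th' : root (map_poly f g) th' ->
  exists s : {rmorphism L -> L}, s th = th' /\ forall c, s (f c) = f c.
Proof.
move=> gr'; have /choice[h hh] := thP.
have key q1 q2 : (map_poly f q1).[th] = (map_poly f q2).[th] ->
    (map_poly f q1).[th'] = (map_poly f q2).[th'].
  move=> e; have /gdiv/dvdpP[q0 hq] : root (map_poly f (q1 - q2)) th.
    by rewrite rootE rmorphB hornerD hornerN e subrr.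
  apply/eqP; rewrite -subr_eq0 -hornerN -hornerD -rmorphB hq rmorphM hornerM.
  by rewrite (eqP gr') mulr0.
pose s y := (map_poly f (h y)).[th'].
have sE q y : (map_poly f q).[th] = y -> s y = (map_poly f q).[th'].
  by move=> e; apply: key; rewrite hh.
have sf c : s (f c) = f c.
  by rewrite (sE c%:P) ?map_polyC ?hornerC.
have [|||s' hs'] := @rmorphism_of L L s.
- move=> x y; rewrite (sE (h x - h y)) ?rmorphB ?hornerD ?hornerN ?hh //.
- by have := sf 1; rewrite rmorph1.
- move=> x y; rewrite (sE (h x * h y)) ?rmorphM ?hornerM ?hh //.
exists s'; split=> [|c]; rewrite hs' //.
by rewrite (sE 'X) ?map_polyX ?hornerX.
Qed.

Lemma conjugate_ext (s t : {rmorphism L -> L}) :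
  (forall c, s (f c) = f c) -> (forall c, t (f c) = f c) -> s th = t th -> s =1 t.
Proof.
move=> sf tf e y; have [q <-] := thP y.
rewrite -!horner_map /= e -!map_poly_comp; congr (_.[_]).
by apply: eq_map_poly => c /=; rewrite sf tf.
Qed.

(** An automorphism fixing k and a square root of -1 has finite order, since
    it permutes the roots of g; one of its powers would have prime order. *)
Lemma fix_sqrtN1_id (s : {rmorphism L -> L}) (I : L) :
  g != 0 -> I ^+ 2 = -1 -> s I = I -> (forall c, s (f c) = f c) -> s =1 id.
Proof.
move=> g0 I2 sI sf.
have itf n : (forall c, iter n s (f c) = f c) /\ iter n s I = I.
  by elim: n => //= n [IH ->]; split=> // c; rewrite IH.
have itr n : root (map_poly f g) (iter n s th).
  have [h hh] := iter_rmorphism s n.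
  have -> : map_poly f g = map_poly h (map_poly f g).
    rewrite -map_poly_comp; apply: eq_map_poly => c /=.
    by rewrite hh; case: (itf n) => ->.
  by rewrite -hh rootE horner_map (eqP gr) rmorph0.
have idE n : iter n s th = th -> forall y, iter n s y = y.
  move=> e y; have [h hh] := iter_rmorphism s n; rewrite -hh.
  apply: (@conjugate_ext h idfun) => //= [c|]; rewrite hh //.
  by case: (itf n) => ->.
have [m m0 hm] : exists2 m, (0 < m)%N & iter m s th = th.
  have : ~~ uniq (traject s th (size g).+1).
    have g0' : map_poly f g != 0 by rewrite map_poly_eq0.
    have rs : all (root (map_poly f g)) (traject s th (size g).+1).
      by apply/allP => _ /trajectP[i _ ->]; apply: itr.
    apply/negP => /(max_poly_roots g0' rs).
    by rewrite size_traject size_map_poly ltnNge leqnSn.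
  rewrite looping_uniq negbK => /trajectP[i ilt /eqP e].
  exists (size g - i)%N; rewrite ?subn_gt0 //; move: e.
  rewrite -{1}(subnKC (ltnW ilt)) iterD => /eqP.
  have [h hh] := iter_rmorphism s i; rewrite -!hh; exact: fmorph_inj.
have : exists n, (0 < n)%N && `[< forall y, iter n s y = y >].
  by exists m; rewrite m0; apply/asboolP/idE.
case/ex_minnP => n /andP[n0 /asboolP hn] nmin.
have [n1|n1] := leqP n 1.
  by move=> y; have := hn y; rewrite (@anti_leq n 1) ?n1.
have [h hh] := iter_rmorphism s (n %/ pdiv n).
have dpos : (0 < n %/ pdiv n)%N by rewrite divn_gt0 ?pdiv_gt0 // pdiv_leq.
have hid : h =1 id.
  apply: (@prime_order_fix_sqrtN1 _ lC h _ (pdiv_prime n1) _ I) => // [y|].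
    rewrite -[RHS]hn -{2}(divnK (pdiv_dvd n)) mulnC iterM.
    exact: eq_iter.
  by rewrite hh; case: (itf (n %/ pdiv n)%N).
have : (n <= n %/ pdiv n)%N.
  by apply: nmin; rewrite dpos; apply/asboolP => y; rewrite -hh hid.
by rewrite leqNgt ltn_Pdiv // prime_gt1 // pdiv_prime.
Qed.

End Generator.

(** By the previous lemma no nontrivial automorphism over k fixes I. Two distinct
    nontrivial ones s and t would both send I to - I, so that s \o s and t \o s
    would be trivial and t = s. Hence a primitive element has at most two
    conjugates, and only one if I is in k. *)
Theorem artin_schreier (I : L) : I ^+ 2 = -1 ->
  (forall y, exists c, y = f c) \/
  ((forall c, I <> f c) /\ forall y, exists a b, y = f a + f b * I).
Proof.
move=> I2; have [th thP] := primitive_generator.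
have [g [ig sg gr gdiv]] := perfect_sep perf (falg th).
have g0 := irredp_neq0 ig.
have fixI := fix_sqrtN1_id thP gr.
have smallE n : (size g <= n.+1)%N -> forall y, exists c : 'I_n -> k,
    y = \sum_(i < n) f (c i) * th ^+ i.
  move=> sz y; have [q <-] := thP y; exists (fun i => (q %% g)`_i).
  rewrite {1}(divp_eq q g) rmorphD rmorphM hornerD hornerM (eqP gr) mulr0 add0r.
  rewrite (@horner_coef_wide _ n); last first.
    by rewrite size_map_poly -ltnS (leq_trans _ sz) // ltn_modp.
  by apply: eq_bigr => a _; rewrite coef_map.
have base : (size g <= 2)%N -> forall y, exists c, y = f c.
  move=> /smallE H y; have [c ->] := H y.
  by exists (c ord0); rewrite big_ord1 expr0 mulr1.
have [|s gs] := closed_split lC (p := (lead_coef (map_poly f g))^-1 *: map_poly f g).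
  by rewrite monicE lead_coefZ mulVf // lead_coef_eq0 map_poly_eq0.
have lc0 : (lead_coef (map_poly f g))^-1 != 0.
  by rewrite invr_eq0 lead_coef_eq0 map_poly_eq0.
have us : uniq s.
  rewrite -separable_prod_XsubC -gs.
  by rewrite (eqp_separable (eqp_scale _ lc0)) separable_map.
have ss : size g = (size s).+1.
  by rewrite -(size_prod_XsubC s id) /= -gs size_scale // size_map_poly.
have rs x : x \in s -> root (map_poly f g) x.
  by rewrite -root_prod_XsubC -gs rootZ.
have Isg (t : {rmorphism L -> L}) : t I = I \/ t I = - I.
  have : (t I) ^+ 2 = I ^+ 2 by rewrite -rmorphXn I2 rmorphN1.
  by move/eqP; rewrite eqf_sqr => /orP[]/eqP; [left|right].
have [[c Ic]|nI] := EM (exists c, I = f c).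
  left; apply: base; rewrite ss ltnS; case: s gs us ss rs => [//|x [//|y s]] _ us _ rs.
  have one z : root (map_poly f g) z -> z = th.
    move=> /(conjugate_morphism thP gdiv)[t [<- tf]].
    by rewrite (fixI t I) // Ic tf.
  have xt : x = th by apply: one; rewrite rs ?inE ?eqxx.
  have yt : y = th by apply: one; rewrite rs ?inE ?eqxx ?orbT.
  by move: us; rewrite xt yt /= inE eqxx.
right; split=> [c e|]; first by apply: nI; exists c.
have two x y : root (map_poly f g) x -> root (map_poly f g) y ->
    x != th -> y != th -> x = y.
  move=> /(conjugate_morphism thP gdiv)[t [<- tf]].
  move=> /(conjugate_morphism thP gdiv)[u [<- uf]] nt nu.
  have tI : t I = - I.
    by have [tI|//] := Isg t; move: nt; rewrite (fixI t I) ?eqxx.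
  have uI : u I = - I.
    by have [uI|//] := Isg u; move: nu; rewrite (fixI u I) ?eqxx.
  have tt : t (t th) = th.
    apply: (fixI (t \o t) I) => //= [|c]; last by rewrite !tf.
    by rewrite tI rmorphN tI opprK.
  have ut : u (t (t th)) = t th.
    apply: (fixI (u \o t) I) => //= [|c]; last by rewrite tf uf.
    by rewrite tI rmorphN uI opprK.
  by rewrite -ut tt.
have sg3 : (size g <= 3)%N.
  rewrite ss ltnS; case: s gs us ss rs => [//|x [//|y [//|z s]]] _ us _ rs.
  have rx : root (map_poly f g) x by rewrite rs ?inE ?eqxx.
  have ry : root (map_poly f g) y by rewrite rs ?inE ?eqxx ?orbT.
  have rz : root (map_poly f g) z by rewrite rs ?inE ?eqxx ?orbT.
  move: us; rewrite /= !inE !negb_or => /and3P[/and3P[xy xz _] /andP[yz _] _].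
  exfalso; have [xt|xt] := eqVneq x th.
    move/eqP: yz; apply; apply: two => //; by rewrite -xt eq_sym.
  have [yt|yt] := eqVneq y th; last by move/eqP: xy; apply; apply: two.
  by move/eqP: xz; apply; apply: two => //; rewrite -yt eq_sym.
move=> y; have [c hc] := smallE 2 sg3 y; have [d hd] := smallE 2 sg3 I.
move: hc hd; rewrite !big_ord_recl !big_ord0 /= expr0 !mulr1 !addr0 /bump /= expr1.
set c0 := c _; set c1 := c _; set d0 := d _; set d1 := d _ => hc hd.
have d1n : f d1 != 0.
  by apply/eqP => d10; apply: nI; exists d0; rewrite hd d10 mul0r addr0.
exists (c0 - c1 * d0 / d1), (c1 / d1); rewrite hc hd.
rewrite !(rmorphB, rmorphM, fmorphV) /=; field.
by rewrite fmorph_eq0 -(fmorph_eq0 f).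
Qed.

End ArtinSchreier.

(** * Real closed fields and their algebraic closure *)

Section RealClosed.
Variables (k L : fieldType) (f : {rmorphism k -> L}).
Hypotheses (lC : GRing.closed_field_axiom L).
Variable I : L.
Hypotheses (I2 : I ^+ 2 = -1) (nI : forall c, I <> f c).
Hypothesis LI : forall y, exists a b, y = f a + f b * I.

Let coordP (a b a' b' : k) : f a + f b * I = f a' + f b' * I -> a = a' /\ b = b'.
Proof.
move=> e; have e' : f (b - b') * I = f (a' - a).
  move/eqP: e; rewrite -subr_eq0 => /eqP e0; apply/eqP.
  by rewrite -subr_eq0 -[eqbRHS]e0 !rmorphB; apply/eqP; ring.
have bb : b = b'.
  apply/eqP; rewrite -subr_eq0; apply/negPn/negP => b0.
  apply: (nI (c := (a' - a) / (b - b'))); rewrite rmorphM fmorphV -e' mulrAC.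
  by rewrite divff ?mul1r // fmorph_eq0.
split=> //; apply: (fmorph_inj f); apply: (addIr (f b * I)).
by rewrite e bb.
Qed.

Let sqrt_coord (a b : k) : exists u v : k, a = u ^+ 2 - v ^+ 2 /\ b = u * v *+ 2.
Proof.
have [w hw] := closed_rootX lC (f a + f b * I) (isT : (0 < 2)%N).
have [u [v huv]] := LI w; exists u, v; apply: coordP; rewrite -hw huv.
rewrite rmorphB !rmorphXn rmorphMn rmorphM.
by rewrite sqrrD exprMn I2; ring.
Qed.

Let N1_nonsquare (c : k) : c ^+ 2 <> -1.
Proof.
move=> hc; have : I ^+ 2 = f c ^+ 2 by rewrite I2 -rmorphXn hc rmorphN1.
move/eqP; rewrite eqf_sqr => /orP[] /eqP h; first exact: (nI h).
by apply: (nI (c := - c)); rewrite rmorphN.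
Qed.

(* The norm of a square root of a + b I is a square root of a ^ 2 + b ^ 2. *)
Let sum_squares (a b : k) : exists c, a ^+ 2 + b ^+ 2 = c ^+ 2.
Proof.
have [u [v [-> ->]]] := sqrt_coord a b.
by exists (u ^+ 2 + v ^+ 2); ring.
Qed.

Let square_or (a : k) : exists u, a = u ^+ 2 \/ - a = u ^+ 2.
Proof.
have [u [v [-> /esym/eqP]]] := sqrt_coord a 0.
rewrite -mulr_natl mulf_eq0 mulf_eq0 => /or3P[/eqP h2|/eqP ->|/eqP ->].
- have /N1_nonsquare[] : (1 : k) ^+ 2 = -1.
  by apply/eqP; rewrite expr1n -subr_eq0 opprK -h2.
- by exists v; right; rewrite expr0n /= sub0r opprK.
- by exists u; left; rewrite expr0n /= subr0.
Qed.

(* The order whose nonnegative elements are the squares. *)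
Let le (x y : k) := `[< exists z, y - x = z ^+ 2 >].
Let lt (x y : k) := (y != x) && le x y.
Let norm (x : k) := if le 0 x then x else - x.

Let le0P (x : k) : le 0 x <-> exists z, x = z ^+ 2.
Proof. by rewrite /le subr0; split => /asboolP. Qed.

Let ge0P (x : k) : le x 0 <-> exists z, - x = z ^+ 2.
Proof. by rewrite /le sub0r; split => /asboolP. Qed.

Let le0_add x y : le 0 x -> le 0 y -> le 0 (x + y).
Proof. by move=> /le0P[a ->] /le0P[b ->]; apply/le0P/sum_squares. Qed.

Let le0_mul x y : le 0 x -> le 0 y -> le 0 (x * y).
Proof.
by move=> /le0P[a ->] /le0P[b ->]; apply/le0P; exists (a * b); rewrite exprMn.
Qed.

Let le0_anti x : le 0 x -> le x 0 -> x = 0.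
Proof.
move=> /le0P[a ->] /ge0P[b hb]; have [->|a0] := eqVneq a 0; first by rewrite expr0n.
case: (@N1_nonsquare (b / a)); rewrite exprMn -hb mulNr exprVn divff //.
by rewrite expf_neq0.
Qed.

Let sub_ge0 x y : le 0 (y - x) = le x y.
Proof. by rewrite /le subr0. Qed.

Let le0_total x : le 0 x || le x 0.
Proof.
have [u [h|h]] := square_or x; apply/orP; [left|right].
  by apply/le0P; exists u.
by apply/ge0P; exists u.
Qed.

Let normN x : norm (- x) = norm x.
Proof.
have e : le 0 (- x) = le x 0 by rewrite -sub0r sub_ge0.
rewrite /norm e; case: ifP => h1; case: ifP => h2 //; last first.
- by have := le0_total x; rewrite h1 h2.
- by rewrite opprK.
by rewrite (le0_anti h2 h1) oppr0.
Qed.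

Let ge0_norm x : le 0 x -> norm x = x.
Proof. by rewrite /norm => ->. Qed.

Let lt_def x y : lt x y = (y != x) && le x y. Proof. by []. Qed.

Definition ordered_base : realFieldType :=
  HB.pack (GRing.Field.sort k)
    (Num.IntegralDomain_isLeReal.Build (GRing.Field.sort k) le0_add le0_mul
      le0_anti sub_ge0 le0_total normN ge0_norm lt_def).

(** A polynomial without root in [a, b] is a product of linear factors with
    root outside and of quadratic factors that are sums of two squares. *)
Lemma no_root_same_sign (a b : ordered_base) : a <= b ->
  forall p : {poly ordered_base}, (forall x, a <= x <= b -> ~~ root p x) ->
  0 < p.[a] * p.[b].
Proof.
move=> ab p; move: {2}(size p) (leqnn (size p)) => n.
elim: n p => [|n IH] p sp hp.
  move: sp (hp a); rewrite leqn0 size_poly_eq0 => /eqP ->.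
  by rewrite root0 lexx ab => /(_ isT).
have p0 : p != 0 by apply: contraTneq (hp a _); rewrite ?lexx // => ->; rewrite root0.
pose F : {rmorphism ordered_base -> L} := f.
have [sp1|sp1] := eqVneq (size p) 1.
  have /size_poly1P[c c0 ->] := introT eqP sp1.
  by rewrite !hornerC -expr2 exprn_even_gt0.
have [|w rw] := closed_has_root lC (p := map_poly F p); first by rewrite size_map_poly.
have IHq q d : p = q * d -> (1 < size d)%N -> 0 < d.[a] * d.[b] -> 0 < p.[a] * p.[b].
  move=> pq sd dab; rewrite pq !hornerM mulrACA mulr_gt0 //.
  have q0 : q != 0 by apply: contraNneq p0 => q0; rewrite pq q0 mul0r.
  apply: IH => [|x /hp]; last by rewrite pq rootM negb_or => /andP[].
  rewrite -ltnS; apply: leq_trans sp; rewrite pq size_mul //; last first.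
    by rewrite -size_poly_gt0 ltnW.
  by case: (size d) sd => [|[|m]] // _; rewrite !addnS /= ltnS leq_addr.
have [u [v wE]] := LI w.
have [v0|v0] := eqVneq v 0.
  have ru : root p u.
    by rewrite -(fmorph_root F) /=; move: rw; rewrite wE v0 rmorph0 mul0r addr0.
  have /factor_theorem[q pq] := ru.
  apply: (IHq q _ pq); rewrite ?size_XsubC // !hornerXsubC.
  have [ua|au] := ltP (u : ordered_base) a.
    by rewrite mulr_gt0 // subr_gt0 // (lt_le_trans ua).
  have [bu|ub] := ltP b (u : ordered_base).
    by rewrite nmulr_rgt0 subr_lt0 // (le_lt_trans ab).
  by move: (hp u); rewrite au ub ru => /(_ isT).
have [m [[m1 im] rm mdiv]] : exists m : {poly ordered_base}, [/\ irreducible_poly m,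
    root (map_poly F m) w & forall q, root (map_poly F q) w -> m %| q].
  by apply: algebraic_min; exists p.
pose Q : {poly ordered_base} := ('X - u%:P) ^+ 2 + (v ^+ 2)%:P.
have sQ : size Q = 3.
  by rewrite size_polyDl size_exp_XsubC // size_polyC; case: (_ != _).
have mQ : m %| Q.
  apply: mdiv; rewrite rootE rmorphD rmorphXn rmorphB /= map_polyX !map_polyC /=.
  rewrite !hornerE wE addrAC subrr add0r exprMn I2 rmorphXn.
  by rewrite mulrN1 addNr.
(* If v != 0 the minimal polynomial of w over k has degree 2, so it is Q up to
   a constant. *)
have Qm : Q %| p.
  have sm : size m = 3.
    have := dvdp_leq _ mQ; rewrite -size_poly_eq0 sQ => /(_ isT).
    rewrite leq_eqVlt => /orP[/eqP//|sm]; exfalso.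
    have {sm} sm : size m = 2 by apply/eqP; rewrite eqn_leq m1 andbT.
    have := size2_root sm rm; rewrite wE => h.
    have : f u + f v * I = f (- m`_0 / m`_1) + f 0 * I by rewrite h rmorph0 mul0r addr0.
    by move/coordP => -[_ /eqP]; rewrite (negbTE v0).
  have : m %= Q by rewrite -dvdp_size_eqp // sm sQ.
  by move/eqp_dvdl <-; apply: mdiv.
have /dvdpP[q pq] := Qm; apply: (IHq q _ pq); rewrite ?sQ //.
rewrite !hornerE; have v2 : 0 < (v : ordered_base) ^+ 2 by rewrite exprn_even_gt0.
by rewrite mulr_gt0 // ltr_wpDl // sqr_ge0.
Qed.

Lemma ordered_base_ivt : Num.real_closed_axiom ordered_base.
Proof.
move=> p a b ab /andP[pa pb]; apply: contrapT => h.
have /(no_root_same_sign ab) : forall x, a <= x <= b -> ~~ root p x.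
  by move=> x hx; apply/negP => rx; apply: h; exists x.
by rewrite ltNge mulr_le0_ge0.
Qed.

(** The converse direction of Artin and Schreier: if k(sqrt -1) is algebraically
    closed and larger than k, then k is real closed for the order given by its
    squares. *)
Lemma quadratic_closure_real_closed : real_closed_field k.
Proof.
pose R : rcfType := HB.pack (Num.RealField.sort ordered_base)
  (Num.RealField_isClosed.Build (Num.RealField.sort ordered_base) ordered_base_ivt).
have [|||g hg] := @rmorphism_of k R (fun x => x) => //.
by exists R, g; exists (fun x => x) => x; rewrite hg.
Qed.
End RealClosed.

(** The field R[i] is algebraically closed, so it contains all that is algebraic
    over R. *)
Lemma real_closed_finite_degree (k L : fieldType) (f : {rmorphism k -> L}) :
  GRing.closed_field_axiom L -> algebraic_ext f -> real_closed_field k ->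
  finite_degree f.
Proof.
move=> lC falg [R [g [g' gK g'K]]].
have [h hE] : exists h : {rmorphism R -> k}, h =1 g'.
  have inj := can_inj gK.
  apply: rmorphism_of => [x y||x y]; apply: inj; rewrite ?rmorphB ?rmorphM ?rmorph1 !g'K //.
have [I I2] := closed_rootX lC (-1) (isT : (0 < 2)%N).
have [F FE] : exists F : {rmorphism R[i] -> L},
    forall z, F z = f (h (complex.Re z)) + f (h (complex.Im z)) * I.
  pose F (z : R[i]) := f (h (complex.Re z)) + f (h (complex.Im z)) * I.
  have [|||F' hF'] := @rmorphism_of _ _ F; last by exists F'.
  - by move=> [a b] [c d]; rewrite /F /= !rmorphB; ring.
  - by rewrite /F /= !rmorph1 !rmorph0; ring.
  - move=> [a b] [c d]; rewrite /F /= !(rmorphB, rmorphM, rmorphD) /=.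
    have -> : f (h a) * f (h c) - f (h b) * f (h d) =
      f (h a) * f (h c) + f (h b) * f (h d) * I ^+ 2 by rewrite I2; ring.
    by ring.
exists 2, (fun i : 'I_2 => I ^+ i) => y.
have [p p0 rp] := falg y.
have [|z ->] := @closed_sub R[i] (@complex_acf_axiom R) L F y.
  exists (map_poly (real_complex R \o g) p); first by rewrite map_poly_eq0.
  rewrite -map_poly_comp; congr (is_true (root _ y)): rp; apply: eq_map_poly => c /=.
  by rewrite FE /= rmorph0 rmorph0 mul0r addr0 hE gK.
exists (fun i : 'I_2 => if i == 0 :> nat then h (complex.Re z) else h (complex.Im z)).
by rewrite FE big_ord_recl big_ord1 /= expr0 mulr1.
Qed.

(** * When the algebraic closure has infinite degree *)

Lemma infinite_closure_iff (k L : fieldType) (f : {rmorphism k -> L}) :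
  perfect_field k -> is_algebraic_closure f ->
  ~ finite_degree f <-> ~ algebraically_closed k /\ ~ real_closed_field k.
Proof.
move=> perf [lC falg]; split=> [nf|[nac nrc] ff].
  split=> [kC|/(real_closed_finite_degree lC falg)//]; apply: nf.
  exists 1, (fun=> 1) => y; have [x ->] := closed_sub kC (falg y).
  by exists (fun=> x); rewrite big_ord1 mulr1.
have [I I2] := closed_rootX lC (-1) (isT : (0 < 2)%N).
have [fs|[nI LI]] := artin_schreier perf lC falg ff I2; last first.
  by apply: nrc; apply: (quadratic_closure_real_closed lC I2 nI LI).
apply: nac => n P n0; have [x hx] := lC n (f \o P) n0.
have [y xy] := fs x; exists y; apply: (fmorph_inj f).
rewrite rmorphXn -xy hx rmorph_sum; apply: eq_bigr => i _ /=.
by rewrite rmorphM rmorphXn -xy.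
Qed.

Lemma finite_degree_comp (k l m : fieldType) (f : {rmorphism k -> l})
    (g : {rmorphism l -> m}) :
  finite_degree f -> finite_degree g -> finite_degree (g \o f).
Proof.
move=> [n [b hb]] [n' [b' hb']].
apply: (@dependent_finite_degree _ _ (g \o f) (n' * n).+1) => u.
apply: (@dependent_span _ _ (g \o f) _ (fun ij : 'I_n' * 'I_n => b' ij.1 * g (b ij.2))).
  by rewrite card_prod !card_ord.
move=> i; have [c ->] := hb' (u i).
have /choice[d hd] := fun j => hb (c j).
exists (fun ij => d ij.1 ij.2).
rewrite -(pair_bigA _ (fun a j => g (f (d a j)) * (b' a * g (b j)))) /=.
apply: eq_bigr => a _; rewrite hd rmorph_sum mulr_suml; apply: eq_bigr => j _.
by rewrite rmorphM mulrAC mulrA.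
Qed.

(** The polynomials 'X^n - 2 are irreducible over the rationals by Eisenstein's
    criterion at 2, for every n. *)
Lemma closure_rat_infinite (L : fieldType) (h : {rmorphism rat -> L}) :
  GRing.closed_field_axiom L -> ~ finite_degree h.
Proof.
move=> lC /finite_degree_dependent[n hn].
have n0 : (0 < n)%N.
  by case: n hn => // hn; case: (hn (fun=> 0)) => a [[[]]].
pose p : {poly int} := 'X^n - 2%:P.
have sp : size p = n.+1 by rewrite size_XnsubC.
have ip : irreducible_poly (map_poly (intr : int -> rat) p).
  apply/irreducible_rat_int; apply: (@eisenstein_crit 2) => //.
  - by rewrite sp eqSS -lt0n.
  - by rewrite (monicP _) // monicXnsubC.
  - by rewrite coefB coefXn coefC eqxx ltn_eqF //= sub0r.
  move=> i; rewrite sp /= => i_n; rewrite coefB coefXn ltn_eqF // sub0r coefC.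
  by case: i i_n.
have [z hz] := closed_rootX lC 2 n0.
have [q [q0 sq rq]] := dependent_powers (hn (fun i => z ^+ i)).
have rz : root (map_poly h (map_poly (intr : int -> rat) p)) z.
  rewrite rootE rmorphB /= map_polyXn map_polyC rmorphB /= map_polyXn map_polyC /=.
  by rewrite !hornerE hz rmorph_int subrr.
have /(dvdp_leq q0) : map_poly (intr : int -> rat) p %| q.
  have : ~~ coprimep (map_poly (intr : int -> rat) p) q.
    rewrite -(coprimep_map h); apply/negP => /coprimep_root/(_ rz).
    by rewrite -rootE rq.
  case: ip => _ ip; rewrite /coprimep => /ip/(_ (dvdp_gcdl _ _)) e.
  by rewrite -(eqp_dvdl _ e) dvdp_gcdr.
rewrite size_rat_int_poly sp => np.
by have := leq_trans np sq; rewrite ltnn.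
Qed.

Lemma infinite_closure_finite_field (k L : fieldType) (f : {rmorphism k -> L}) :
  GRing.closed_field_axiom L -> finite_field k -> ~ finite_degree f.
Proof.
by move=> lC [s ks] /(base_infinite lC)/(_ s)[x]; rewrite ks.
Qed.

Lemma infinite_closure_number_field (k L : fieldType) (f : {rmorphism k -> L}) :
  GRing.closed_field_axiom L -> number_field k -> ~ finite_degree f.
Proof.
move=> lC [g fg] ff; exact: (closure_rat_infinite lC (finite_degree_comp fg ff)).
Qed.

(** * Residue fields *)

Definition is_ring_of (F : fieldType) (V : valuation_ring F) (w : valuation F) :=
  forall x, (x \in (V : {pred F})) = vge w 0 x.

Lemma DVR_is_ring_of (F : fieldType) (V : valuation_ring F) (w : valuation F) :
  DVR_with_valuation V w -> is_ring_of V w.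
Proof. by case=> _ h x; rewrite h vgeE. Qed.

Section RingOf.
Variables (F : fieldType) (w : valuation F).
Let P : {pred F} := [pred x | vge w 0 x].
Fact ring_of1 : 1 \in P. Proof. exact: vge1. Qed.
Fact ring_ofB x y : x \in P -> y \in P -> x - y \in P. Proof. exact: vgeB. Qed.
Fact ring_ofM x y : x \in P -> y \in P -> x * y \in P. Proof. exact: vgeM0. Qed.
Fact ring_ofV x : x != 0 -> (x \in P) || (x^-1 \in P).
Proof.
move=> x0; rewrite !inE /vge invr_eq0 !(negbTE x0) ordV //= oppr_ge0.
exact: le_total.
Qed.
Definition ring_of := ValuationRing ring_of1 ring_ofB ring_ofM ring_ofV.
End RingOf.

Section Residue.
Variables (F : fieldType) (V : valuation_ring F) (w : valuation F).
Hypothesis Vw : is_ring_of V w.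

(** Reduction as a total function on F; it is 0 outside V. *)
Definition res (x : F) : residue_field V := residue (insubd (0 : vring_elt V) x).

Let valI x : vge w 0 x -> val (insubd (0 : vring_elt V) x) = x.
Proof. by move=> h; rewrite val_insubd Vw h. Qed.

Let resE (x : vring_elt V) : residue x = res (val x).
Proof. by congr residue; apply: val_inj; rewrite /= valI // -Vw (valP x). Qed.

Lemma res_surj y : exists2 x, vge w 0 x & y = res x.
Proof.
exists (val (repr y)); first by rewrite -Vw (valP (repr y)).
by rewrite -resE /residue reprK.
Qed.

Let pi : {rmorphism vring_elt V -> residue_field V} :=
  \pi_({ideal_quot (@max_ideal _ V)})%qT.

Lemma resB x y : vge w 0 x -> vge w 0 y -> res (x - y) = res x - res y.
Proof.
move=> hx hy; have := rmorphB pi (insubd 0 x) (insubd 0 y).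
rewrite -[LHS]/(residue _) resE /= !valI //.
Qed.

Lemma resM x y : vge w 0 x -> vge w 0 y -> res (x * y) = res x * res y.
Proof.
move=> hx hy; have := rmorphM pi (insubd 0 x) (insubd 0 y).
rewrite -[LHS]/(residue _) resE /= !valI //.
Qed.

Lemma res1 : res 1 = 1.
Proof. by have := rmorph1 pi; rewrite -[LHS]/(residue _) resE. Qed.

Lemma res_eq0 x : vge w 0 x -> (res x == 0) = vgt w 0 x.
Proof.
move=> hx; have -> : (res x == 0) = (insubd (0 : vring_elt V) x \in @max_ideal _ V).
  by rewrite -[X in X \in _]subr0 Quotient.idealrBE; rewrite (rmorph0 pi).
rewrite inE /= valI // Vw.
have [->|x0] := eqVneq x 0; first by rewrite vgt0.
by rewrite /vge /vgt invr_eq0 (negbTE x0) /= ordV // oppr_ge0 ltNge.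
Qed.

Lemma res0 : res 0 = 0.
Proof. by apply/eqP; rewrite res_eq0. Qed.

Lemma res_eq x y : vge w 0 x -> vge w 0 y -> (res x == res y) = vgt w 0 (x - y).
Proof. by move=> hx hy; rewrite -subr_eq0 -resB // res_eq0 // vgeB. Qed.

Lemma resD x y : vge w 0 x -> vge w 0 y -> res (x + y) = res x + res y.
Proof.
by move=> hx hy; rewrite -[y in LHS]opprK -[- y]sub0r !resB ?vgeB // res0 sub0r opprK.
Qed.

Lemma resX x n : vge w 0 x -> res (x ^+ n) = res x ^+ n.
Proof.
move=> hx; elim: n => [|n IH]; first exact: res1.
by rewrite !exprS resM ?vgeX0 // IH.
Qed.

Lemma res_sum (I : Type) (r : seq I) (P : pred I) (G : I -> F) :
  (forall i, P i -> vge w 0 (G i)) ->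
  res (\sum_(i <- r | P i) G i) = \sum_(i <- r | P i) res (G i).
Proof.
move=> h; suff [] : res (\sum_(i <- r | P i) G i) = \sum_(i <- r | P i) res (G i) /\
  vge w 0 (\sum_(i <- r | P i) G i) by [].
apply: (big_rec2 (fun a b => res b = a /\ vge w 0 b)); first by rewrite res0.
by move=> i a b Pi [<- hb]; rewrite resD ?vgeD ?h.
Qed.

Lemma res_horner (p : {poly F}) x :
  (forall i, vge w 0 p`_i) -> vge w 0 x -> (map_poly res p).[res x] = res p.[x].
Proof.
move=> hp hx; rewrite horner_poly horner_coef res_sum => [|i _]; last first.
  by rewrite vgeM0 // vgeX0.
by apply: eq_bigr => i _; rewrite resM ?vgeX0 // resX.
Qed.

End Residue.

Lemma ring_of_extends (K L : fieldType) (f : {rmorphism K -> L})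
    (V : valuation_ring K) (W : valuation_ring L) (v : valuation K)
    (w : valuation L) : is_ring_of V v -> is_ring_of W w -> extends_valuation f v w ->
  extends_ring f V W.
Proof. by move=> Vv Ww vw x; rewrite Ww Vv (vge_ext _ _ vw). Qed.

Section ResidueMap.
Variables (K L : fieldType) (f : {rmorphism K -> L}).
Variables (V : valuation_ring K) (W : valuation_ring L).
Variables (v : valuation K) (w : valuation L).
Hypotheses (Vv : is_ring_of V v) (Ww : is_ring_of W w) (VW : extends_ring f V W).

Let f0 x : vge w 0 (f x) = vge v 0 x.
Proof. by rewrite -Ww -Vv. Qed.

Lemma residue_mapR x : vge v 0 x -> residue_map f W (res V x) = res W (f x).
Proof.
move=> hx; rewrite /res residue_mapE //.
by congr (residue (insubd _ (f _))); rewrite val_insubd Vv hx.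
Qed.

Lemma residue_map_morph :
  exists h : {rmorphism residue_field V -> residue_field W}, h =1 residue_map f W.
Proof.
have fi x : vge v 0 x -> vge w 0 (f x) by rewrite f0.
apply: rmorphism_of => [y z||y z].
- have [a ha ->] := res_surj Vv y; have [b hb ->] := res_surj Vv z.
  by rewrite -(resB Vv) // !residue_mapR ?vgeB // rmorphB (resB Ww) ?fi.
- by rewrite -(res1 Vv) residue_mapR // rmorph1 (res1 Ww).
- have [a ha ->] := res_surj Vv y; have [b hb ->] := res_surj Vv z.
  by rewrite -(resM Vv) // !residue_mapR ?vgeM0 // rmorphM (resM Ww) ?fi.
Qed.

(** An integral relation with a unit coefficient reduces to a nonzero relation. *)
Lemma residue_algebraic y (P : {poly K}) : vge w 0 y ->
  (forall i, vge v 0 P`_i) -> (exists i, ~~ vgt v 0 P`_i) ->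
  vgt w 0 (map_poly f P).[y] -> algebraicOver (@residue_map _ _ f V W) (res W y).
Proof.
move=> hy hP [i Pi] Py; exists (map_poly (res V) P).
  apply: contraNneq Pi => /polyP/(_ i).
  rewrite coef_map_id0 ?(res0 Vv) // coef0 => /eqP.
  by rewrite (res_eq0 Vv).
have hfP j : vge w 0 (map_poly f P)`_j by rewrite coef_map f0.
have [h hh] := residue_map_morph; rewrite -(eq_map_poly hh).
rewrite rootE; have -> : map_poly h (map_poly (res V) P) = map_poly (res W) (map_poly f P).
  apply/polyP => j; transitivity (h (res V P`_j)).
    by rewrite coef_map /= coef_map_id0 ?(res0 Vv).
  by rewrite hh residue_mapR // coef_map_id0 ?(res0 Ww) // coef_map.
by rewrite (res_horner Ww) // (res_eq0 Ww) // vge_horner.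
Qed.

End ResidueMap.

(** Roots of integral monic polynomials are integral, so that a root of a lift
    reduces to a root. *)
Lemma residue_closed (L : fieldType) (W : valuation_ring L) (w : valuation L) :
  is_ring_of W w -> GRing.closed_field_axiom L ->
  GRing.closed_field_axiom (residue_field W).
Proof.
move=> Ww lC n P n0.
have /choice[Q hQ] : forall i, exists x, vge w 0 x /\ P i = res W x.
  by move=> i; have [x ? ?] := res_surj Ww (P i); exists x.
have [x hx] := lC n Q n0.
have x0 : vge w 0 x.
  have [->|xn0] := eqVneq x 0; first exact: vge0.
  apply/negPn/negP => xneg.
  have ox : ord w x < 0 by move: xneg; rewrite /vge (negbTE xn0) /= ltNge.
  have : vgt w (ord w (x ^+ n)) (x ^+ n).
    rewrite {2}hx vgt_sum // => i _; rewrite ordX //.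
    have : vge w (0 + ord w x *+ i) (Q i * x ^+ i).
      by apply: vgeM; [case: (hQ i) | apply: vge_ord; rewrite ordX].
    rewrite add0r; apply: vge_vgt.
    by rewrite -mulr_natr -[_ *+ i]mulr_natr ltr_nM2l // ltr_nat.
  by rewrite /vgt expf_eq0 (negbTE xn0) andbF ltxx.
exists (res W x); rewrite -(resX Ww) // hx (res_sum Ww) => [|i _].
  apply: eq_bigr => i _; have [h1 ->] := hQ i.
  by rewrite (resM Ww) ?vgeX0 // (resX Ww).
by rewrite vgeM0 ?vgeX0 //; case: (hQ i).
Qed.

(** * Completions *)

Lemma rat_nat_bound (e : rat) : exists n : nat, e <= n%:R.
Proof.
exists (Num.bound `|e|); apply: le_trans (ler_norm e) (ltW _).
exact: archi_boundP.
Qed.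

Lemma vge_nat_all (F : fieldType) (w : valuation F) x :
  (forall n : nat, vge w n%:R x) -> x = 0.
Proof.
move=> h; apply: (vge_all (w := w)) => e; have [n hn] := rat_nat_bound e.
exact: vge_le hn (h n).
Qed.

Lemma normalized_ord (F : fieldType) (w : valuation F) :
  normalized w -> (forall x, x != 0 -> ord w x \is a Num.int) /\
  exists2 x, x != 0 & ord w x = 1.
Proof.
move=> wZ; split=> [x x0|].
  by apply/wZ; exists x => //; apply: valE.
have [x x0 hx] : exists2 x, x != 0 & w x = 1%:E by apply/wZ.
by exists x => //; rewrite /ord hx.
Qed.

Lemma ord_normalized (F : fieldType) (w : valuation F) x :
  (forall x, x != 0 -> ord w x \is a Num.int) -> x != 0 -> ord w x = 1 ->
  normalized w.
Proof.
move=> wZ x0 wx q; split=> [[y y0 wy]|/intrP[m ->]].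
  by have := wZ y y0; rewrite /ord wy.
case: m => m; last first.
  exists (x ^- m.+1); rewrite ?invr_eq0 ?expf_neq0 //.
  by rewrite valE ?invr_eq0 ?expf_neq0 // ordV ?expf_neq0 // ordX // wx NegzE rmorphN.
exists (x ^+ m); first by rewrite expf_neq0.
by rewrite valE ?expf_neq0 // ordX // wx.
Qed.

Section Completion.
Variables (F G : fieldType) (v : valuation F) (w : valuation G).
Variable f : {rmorphism F -> G}.
Hypothesis cfg : is_completion v w f.

Lemma completion_ext : extends_valuation f v w. Proof. by case: cfg. Qed.

Lemma completion_approx y e : exists x, vge w e (y - f x).
Proof. by case: cfg => _ /(_ y e)[x] + _; rewrite vgeE; exists x. Qed.

Lemma completion_series (u : nat -> G) :
  (forall n, vge w n%:R (u n.+1 - u n)) -> exists l, forall n, vge w n%:R (l - u n).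
Proof.
move=> hu; have hmn n m : vge w n%:R (u (n + m)%N - u n).
  elim: m => [|m IH]; first by rewrite addn0 subrr.
  rewrite addnS -(subrK (u (n + m)%N) (u _.+1)) -addrA vgeD //.
  by apply: vge_le (hu (n + m)%N); rewrite ler_nat leq_addr.
have [l hl] : exists l, converges_to w u l.
  case: cfg => _ _; apply => e; have [N hN] := rat_nat_bound e.
  exists N => m n hm hn; rewrite vgeE; apply: (vge_le hN).
  rewrite -(subnKC hm) -(subnKC hn) -(subrK (u N) (u (N + (m - N))%N)) -addrA.
  by rewrite vgeD // -vgeN opprB.
exists l => n; have [N /(_ (n + N)%N (leq_addl _ _))] := hl n%:R.
rewrite vgeE => h; rewrite -(subrK (u (n + N)%N) l) -addrA vgeD //.
by rewrite -vgeN opprB.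
Qed.

End Completion.

(** An element of the completion has the value of any close enough element of
    the base. *)
Lemma completion_int (F G : fieldType) (v : valuation F) (w : valuation G)
    (f : {rmorphism F -> G}) : is_completion v w f -> 
  (forall x, x != 0 -> ord v x \is a Num.int) ->
  forall y, y != 0 -> ord w y \is a Num.int.
Proof.
move=> cfg vZ y y0; have [x hx] := completion_approx cfg y (ord w y + 1).
have [xy0 e] : y + - (y - f x) != 0 /\ ord w (y + - (y - f x)) = ord w y.
  by apply: vgt_dom => //; rewrite vgtN; apply: vge_vgt hx; rewrite ltrDl.
move: xy0 e; rewrite subKr fmorph_eq0 (ord_ext _ (completion_ext cfg)) => x0 <-.
exact: vZ.
Qed.

Lemma min_coef (F : fieldType) (w : valuation F) (Q : {poly F}) : Q != 0 ->
  exists i, Q`_i != 0 /\ forall j, vge w (ord w Q`_i) Q`_j.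
Proof.
elim/poly_ind: Q => [|q a IH]; first by rewrite eqxx.
have [->|q0 _] := eqVneq q 0.
  rewrite mul0r add0r polyC_eq0 => a0; exists 0; rewrite coefC /=; split=> // j.
  by rewrite coefC; case: eqP => _ //; apply: vge_ord.
have cE j : (q * 'X + a%:P)`_j = if j is j'.+1 then q`_j' else a.
  by rewrite coefD coefMX coefC; case: j => [|j] /=; rewrite ?add0r ?addr0.
have [i [qi hi]] := IH q0.
have [a_ge|a_lt] := boolP (vge w (ord w q`_i) a).
  by exists i.+1; rewrite !cE; split=> // -[|j]; rewrite cE.
have a0 : a != 0 by apply: contraNneq a_lt => ->.
exists 0; rewrite !cE; split=> // -[|j]; rewrite cE; first exact: vge_ord.
apply: vge_le (hi j); move: a_lt; rewrite /vge (negbTE a0) /= -ltNge; exact: ltW.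
Qed.

(** An integral element algebraic over a completion satisfies, up to positive
    valuation, an equation over the base that is not trivial modulo the maximal
    ideal: divide by the smallest coefficient and approximate. *)
Lemma integral_relation (K H L : fieldType) (v : valuation K) (vh : valuation H)
    (w : valuation L) (f : {rmorphism K -> H}) (j : {rmorphism H -> L}) (y : L) :
  is_completion v vh f -> extends_valuation j vh w -> algebraicOver j y ->
  vge w 0 y -> exists P : {poly K}, [/\ forall i, vge v 0 P`_i,
    exists i, ~~ vgt v 0 P`_i & vgt w 0 (map_poly (j \o f) P).[y]].
Proof.
move=> cf jw [Q Q0 rQ] hy; have fe := completion_ext cf.
have [i0 [Qi0 hQ]] := min_coef vh Q0.
have /choice[x hx] : forall i, exists x, vge vh 1 (Q`_i / Q`_i0 - f x).
  by move=> i; apply: (completion_approx cf).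
pose P := \poly_(i < size Q) x i.
have hQ1 i : vge vh 0 (Q`_i / Q`_i0).
  by rewrite -(subrr (ord vh Q`_i0)) vgeM // vge_ord // ordV.
have hP i : vgt vh 0 (Q`_i / Q`_i0 - f P`_i).
  rewrite coef_poly; case: ltnP => hi; first by apply: vge_vgt (hx i).
  by rewrite rmorph0 nth_default // mul0r subr0.
exists P; split.
- by move=> i; rewrite -(vge_ext _ _ fe) -(vge_congr (vgt_vge (hP i))).
- exists i0; rewrite -(vgt_ext _ _ fe) -(vgt_congr (hP i0)) divff //.
  by rewrite vgt1.
have sP : (size (map_poly (j \o f) P) <= size Q)%N.
  by rewrite size_map_poly size_poly.
have z : \sum_(i < size Q) j (Q`_i / Q`_i0) * y ^+ i = 0.
  transitivity ((j Q`_i0)^-1 * (map_poly j Q).[y]); last by rewrite (eqP rQ) mulr0.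
  rewrite horner_coef size_map_poly mulr_sumr; apply: eq_bigr => i _.
  by rewrite coef_map mulrA rmorphM fmorphV [_^-1 * _]mulrC.
rewrite (horner_coef_wide _ sP) -[X in vgt _ _ X]subr0 -[X in _ - X]z -sumrB.
apply: vgt_sum => i _; rewrite -mulrBl vgtMl ?vgeX0 //.
by rewrite coef_map /= -rmorphB (vgt_ext _ _ jw) -vgtN opprB.
Qed.

(** * Residually finite discrete extensions *)

Section Generation.
Variables (K E : fieldType) (f : {rmorphism K -> E}).
Variables (v : valuation K) (w : valuation E).
Variables (V : valuation_ring K) (W : valuation_ring E).
Hypotheses (Vv : is_ring_of V v) (Ww : is_ring_of W w) (vw : extends_valuation f v w).
Variable up : K.
Hypotheses (up0 : up != 0) (upv : ord v up = 1).
Variable u : valuation E.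
Hypothesis Wu : DVR_with_valuation W u.
Hypothesis fin : finite_degree (@residue_map _ _ f V W).

Let wu0 x : vge u 0 x = vge w 0 x.
Proof. by rewrite -(DVR_is_ring_of Wu) Ww. Qed.

(* u and w have the same valuation ring, hence the same maximal ideal, but they
   may differ by a factor, the ramification index. *)
Let wup x : vgt u 0 x = vgt w 0 x.
Proof.
have h z : vgt z 0 x = (x == 0) || ~~ vge z 0 x^-1 :> bool.
  rewrite /vgt /vge invr_eq0; have [//|x0] /= := eqVneq x 0.
  by rewrite ordV // oppr_ge0 ltNge.
by rewrite !h wu0.
Qed.

Let lift_residues : exists n (b : 'I_n -> E), (forall i, vge w 0 (b i)) /\
  forall x, vge w 0 x -> exists c : 'I_n -> K, (forall i, vge v 0 (c i)) /\
    vgt w 0 (x - \sum_i f (c i) * b i).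
Proof.
have [n [b hb]] := fin.
have /choice[b' hb'] : forall i, exists b', vge w 0 b' /\ b i = res W b'.
  by move=> i; have [x ? ?] := res_surj Ww (b i); exists x.
exists n, b'; split=> [i|x hx]; first by case: (hb' i).
have [c hc] := hb (res W x).
have /choice[c' hc'] : forall i, exists c', vge v 0 c' /\ c i = res V c'.
  by move=> i; have [y ? ?] := res_surj Vv (c i); exists y.
have hcb i : vge w 0 (f (c' i) * b' i).
  by rewrite vgeM0 ?(vge_ext _ _ vw) //; [case: (hc' i) | case: (hb' i)].
exists c'; split=> [i|]; first by case: (hc' i).
rewrite -(res_eq Ww) // ?vge_sum // hc (res_sum Ww) //; apply/eqP.
apply: eq_bigr => i _; have [h1 ->] := hc' i; have [h2 ->] := hb' i.
by rewrite (resM Ww) ?(vge_ext _ _ vw) // (residue_mapR Vv (ring_of_extends Vv Ww vw)).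
Qed.

(** With t a uniformizer of W and e the ramification index, the products
    t ^ i * b_l for i < e, where the b_l lift a basis of the residue field,
    generate W modulo the uniformizer of V. *)
Lemma residual_generators : exists (I : finType) (B : I -> E),
  (forall i, vge w 0 (B i)) /\
  forall x, vge w 0 x -> exists c : I -> K, (forall i, vge v 0 (c i)) /\
    vge w 1 (x - \sum_i f (c i) * B i).
Proof.
have [n [b [hb gen]]] := lift_residues.
have [uZ [t t0 ut]] := normalized_ord Wu.1.
have fup0 : f up != 0 by rewrite fmorph_eq0.
have [e eE] : exists e : nat, ord u (f up) = e%:R.
  have : vgt u 0 (f up) by rewrite wup (vgt_ext _ _ vw) vgt_ord // upv.
  rewrite /vgt (negbTE fup0) /= => h.
  by have /intrP[[m|m] hm] := uZ _ fup0; [exists m | move: h; rewrite hm ltr0z].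
have tW : vge w 0 t by rewrite -wu0 vge_ord // ut.
have divt x : vgt w 0 x -> vge w 0 (x / t).
  have [->|x0] := eqVneq x 0; first by rewrite mul0r.
  rewrite -wup -wu0 /vgt (negbTE x0) /= => h; apply: vge_ord.
  rewrite ordM ?invr_eq0 // ordV // ut subr_ge0.
  have /intrP[m hm] := uZ _ x0; move: h; rewrite hm ltr0z => h.
  by rewrite ler1z.
have te : vge w 1 (t ^+ e).
  rewrite -(divfK fup0 (t ^+ e)) -[1]add0r vgeM //.
    by rewrite -wu0 vge_ord // ordM ?expf_neq0 ?invr_eq0 // ordV // ordX // ut eE subrr.
  by rewrite (vge_ext _ _ vw) vge_ord // upv.
have /choice[c hc] : forall x, exists c : 'I_n -> K, vge w 0 x ->
    (forall i, vge v 0 (c i)) /\ vgt w 0 (x - \sum_i f (c i) * b i).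
  move=> x; have [/gen[c hc]|_] := boolP (vge w 0 x); first by exists c.
  by exists (fun=> 0).
pose N x := (x - \sum_i f (c x i) * b i) / t.
have NW m x : vge w 0 x -> vge w 0 (iter m N x).
  by move=> hx; elim: m => //= m IH; apply/divt; case: (hc _ IH).
have step m x : x = \sum_(i < m) \sum_l f (c (iter i N x) l) * (t ^+ i * b l) +
    t ^+ m * iter m N x.
  elim: m => [|m IH]; first by rewrite big_ord0 add0r expr0 mul1r.
  rewrite [LHS]IH big_ord_recr /= -addrA; congr (_ + _).
  rewrite {2}/N exprSr -mulrA [t * _]mulrC divfK // mulrBr mulr_sumr.
  rewrite [X in _ = X + _](eq_bigr (fun l => t ^+ m * (f (c (iter m N x) l) * b l))).
    by rewrite addrC subrK.
  by move=> l _; rewrite mulrCA.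
exists ('I_e * 'I_n)%type, (fun il : 'I_e * 'I_n => t ^+ il.1 * b il.2); split.
  by move=> i; rewrite vgeM0 ?vgeX0.
move=> x hx; exists (fun il : 'I_e * 'I_n => c (iter il.1 N x) il.2); split.
  by move=> i; case: (hc _ (NW i.1 x hx)).
rewrite -(pair_bigA _ (fun (i : 'I_e) (l : 'I_n) => f (c (iter i N x) l) * (t ^+ i * b l))) /=.
rewrite {1}(step e x) [X in vge _ _ X]addrAC subrr add0r -[1]addr0 vgeM //.
exact: NW.
Qed.

End Generation.

(** Successive approximation: the coefficients modulo the powers of the uniformizer
    up converge in the completion H of K. Elements of E that are not integral are
    first multiplied by a power of up. *)
Lemma complete_span (K H C E : fieldType) (v : valuation K) (vh : valuation H)
    (w : valuation C) (wE : valuation E) (h : {rmorphism K -> H})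
    (g : {rmorphism H -> C}) (f : {rmorphism K -> E}) (ev : {rmorphism E -> C})
    (up : K) (I : finType) (B : I -> E) :
  is_completion v vh h -> extends_valuation g vh w -> extends_valuation ev wE w ->
  (forall x, g (h x) = ev (f x)) -> up != 0 -> ord v up = 1 ->
  extends_valuation f v wE ->
  (forall i, vge wE 0 (B i)) ->
  (forall x, vge wE 0 x -> exists c : I -> K, (forall i, vge v 0 (c i)) /\
    vge wE 1 (x - \sum_i f (c i) * B i)) ->
  forall x, exists c : I -> H, ev x = \sum_i g (c i) * ev (B i).
Proof.
move=> ch gw evw gh up0 upv fw hB gen.
suff intE x : vge wE 0 x -> exists c : I -> H, ev x = \sum_i g (c i) * ev (B i).
  move=> x; have [->|x0] := eqVneq x 0; first exact: intE.
  have [n hn] := rat_nat_bound (- ord wE x).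
  have fup0 : f up ^+ n != 0 by rewrite expf_neq0 // fmorph_eq0.
  have [|c hc] := intE (f up ^+ n * x).
    by rewrite vge_ord // ordM // ordX ?fmorph_eq0 // (ord_ext _ fw) upv; lra.
  exists (fun l => h up ^- n * c l).
  have ghup0 : ev (f up) ^+ n != 0 by rewrite expf_neq0 // !fmorph_eq0.
  apply: (mulfI ghup0); move: hc; rewrite rmorphM !rmorphXn => ->.
  rewrite mulr_sumr; apply: eq_bigr => l _.
  by rewrite rmorphM fmorphV rmorphXn gh !mulrA divff // mul1r.
move=> hx.
have fup0 : f up != 0 by rewrite fmorph_eq0.
have /choice[c hc] : forall x, exists c : I -> K, vge wE 0 x ->
    (forall i, vge v 0 (c i)) /\ vge wE 1 (x - \sum_i f (c i) * B i).
  move=> y; have [/gen[c hc]|_] := boolP (vge wE 0 y); first by exists c.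
  by exists (fun=> 0).
pose N y := (y - \sum_i f (c y i) * B i) / f up.
have NW m : vge wE 0 (iter m N x).
  elim: m => //= m IH; rewrite -(subrr 1) vgeM //; first by case: (hc _ IH).
  by rewrite vge_ord // ordV // (ord_ext _ fw) upv.
pose S n i := \sum_(m < n) c (iter m N x) i * up ^+ m.
have step n : x = \sum_i f (S n i) * B i + f up ^+ n * iter n N x.
  elim: n => [|n IH].
    rewrite big1 ?add0r ?expr0 ?mul1r // => i _.
    by rewrite /S big_ord0 rmorph0 mul0r.
  rewrite [LHS]IH /S; under [in RHS]eq_bigr => i _ do
    rewrite big_ord_recr rmorphD mulrDl.
  rewrite big_split /= -addrA; congr (_ + _).
  rewrite {2}/N exprSr -mulrA [f up * _]mulrC divfK // mulrBr mulr_sumr.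
  rewrite [X in _ = X + _](eq_bigr (fun i => f up ^+ n * (f (c (iter n N x) i) * B i))).
    by rewrite addrC subrK.
  by move=> i _; rewrite rmorphM rmorphXn mulrA [f (c _ _) * _]mulrC.
have /choice[l hl] : forall i, exists l, forall n, vge vh n%:R (l - h (S n i)).
  move=> i; apply: (completion_series ch) => n.
  rewrite -rmorphB (vge_ext _ _ (completion_ext ch)) /S big_ord_recr /= addrAC subrr add0r.
  rewrite -[n%:R]add0r vgeM //; first by case: (hc _ (NW n)).
  by rewrite vge_ord // ordX // upv.
exists l; apply/eqP; rewrite -subr_eq0; apply/eqP; apply: (vge_nat_all (w := w)) => n.
rewrite {1}(step n) rmorphD rmorph_sum addrAC -sumrB vgeD //.
  apply: vge_sum => i _; rewrite rmorphM -mulrBl -gh -rmorphB -[n%:R]addr0 vgeM //.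
    by rewrite (vge_ext _ _ gw) -vgeN opprB.
  by rewrite (vge_ext _ _ evw).
rewrite (vge_ext _ _ evw) -[n%:R]addr0 vgeM //.
by rewrite vge_ord // ordX // (ord_ext _ fw) upv.
Qed.

(** * Perfect fields and p-th roots *)

Lemma perfect_pth_root (k l : fieldType) (f : {rmorphism k -> l}) p (a : k) :
  perfect_field k -> GRing.closed_field_axiom l -> algebraic_ext f ->
  p \in [pchar k] -> exists b, b ^+ p = a.
Proof.
move=> perf lC falg cp; have [b hb] := closed_rootX lC (f a) (prime_gt0 (pcharf_prime cp)).
have cpl : p \in [pchar l] by rewrite (fmorph_pchar f).
have [m [im sm rm mdiv]] := perfect_sep perf (falg b).
have mX : map_poly f m %| ('X - b%:P) ^+ p.
  have -> : ('X - b%:P) ^+ p = map_poly f ('X^p - a%:P).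
    by rewrite pcharB ?pchar_poly // -polyC_exp hb rmorphB /= map_polyXn map_polyC.
  rewrite dvdp_map; apply: mdiv.
  by rewrite rootE rmorphB /= map_polyXn map_polyC !hornerE hb subrr.
have /factor_theorem[q mq] := rm.
have qb : ~~ root q b.
  by move: sm; rewrite -(separable_map f) mq separable_root => /andP[].
have sq : size q = 1.
  apply/eqP; have : coprimep q (('X - b%:P) ^+ p).
    by rewrite coprimep_expr // coprimep_XsubC.
  have qX : q %| ('X - b%:P) ^+ p.
    by apply: dvdp_trans mX; rewrite mq dvdp_mulr.
  by move/(coprimep_dvdl qX); rewrite coprimepp.
have sm2 : size m = 2.
  have q0 : q != 0 by rewrite -size_poly_eq0 sq.
  by rewrite -(size_map_poly f) mq size_mul ?polyXsubC_eq0 // sq size_XsubC.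
have bE := size2_root sm2 rm.
by exists (- m`_0 / m`_1); apply: (fmorph_inj f); rewrite rmorphXn -bE hb.
Qed.

(** Over a perfect field k the extensions k(x) and k(x ^+ p) have the same degree:
    the first d powers of x ^+ p are independent because k = k ^ p. *)
Lemma pth_root_closed (k l : fieldType) (f : {rmorphism k -> l}) p (E : l -> Prop) x :
  perfect_field k -> GRing.closed_field_axiom l -> algebraic_ext f ->
  p \in [pchar l] -> (forall c, E (f c)) ->
  (forall y z, E y -> E z -> E (y - z)) -> (forall y z, E y -> E z -> E (y * z)) ->
  E (x ^+ p) -> E x.
Proof.
move=> perf lC falg cp Ec EB EM Exp.
have cpk : p \in [pchar k] by rewrite -(fmorph_pchar f).
have E0 : E 0 by rewrite -(rmorph0 f).
have ED y z : E y -> E z -> E (y + z).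
  by move=> hy hz; rewrite -[z]opprK; apply: (@EB) => //; rewrite -sub0r; apply: (@EB).
have [m [[m1 _] rm mdiv]] := algebraic_min (falg x).
have m0 : m != 0 by rewrite -size_poly_gt0 ltnW.
pose d := (size m).-1.
have sd : size m = d.+1 by rewrite /d prednK // ltnW.
have spanx n : exists c : 'I_d -> k, x ^+ n = \sum_i f (c i) * x ^+ i.
  exists (fun i => ('X^n %% m)`_i).
  have -> : x ^+ n = (map_poly f 'X^n).[x] by rewrite map_polyXn hornerXn.
  rewrite {1}(divp_eq 'X^n m) rmorphD rmorphM hornerD hornerM (eqP rm) mulr0 add0r.
  rewrite (@horner_coef_wide _ d); last by rewrite size_map_poly -ltnS -sd ltn_modp.
  by apply: eq_bigr => i _; rewrite coef_map.
pose u (i : 'I_d.+1) := if unlift ord0 i is Some j then x ^+ (p * j) else x.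
have [|i|a [[i0 ai0] au]] := @dependent_span _ _ f 'I_d (fun i => x ^+ i) d.+1 u.
- by rewrite card_ord.
- rewrite /u; case: (unlift ord0 i) => [j|]; first exact: spanx.
  by have [c hc] := spanx 1; exists c; rewrite -hc expr1.
move: au; rewrite big_ord_recl /u unlift_none.
under eq_bigr => i _ do rewrite liftK.
have [a0|a0] := eqVneq (a ord0) 0; last first.
  move=> h; have -> : x = - (f (a ord0)^-1 * \sum_(i < d) f (a (lift ord0 i)) * x ^+ (p * i)).
    apply/eqP; rewrite -addr_eq0; apply/eqP.
    have fa : f (a ord0) != 0 by rewrite fmorph_eq0.
    by apply: (mulfI fa); rewrite fmorphV mulrDr mulrA divff // mul1r mulr0.
  rewrite -sub0r; apply: (@EB) => //; apply: (@EM) => //.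
  elim/big_ind: _ => // i _; apply: (@EM) => //; rewrite exprM.
  by elim: (val i) => [|n IH]; rewrite ?expr0 -?(rmorph1 f) // exprS; apply: (@EM).
rewrite a0 rmorph0 mul0r add0r => s0; exfalso.
have /choice[b hb] : forall i : 'I_d, exists b, b ^+ p = a (lift ord0 i).
  by move=> i; apply: (perfect_pth_root _ perf lC falg cpk).
pose q := \poly_(i < d) oapp b 0 (insub i).
have qE (i : 'I_d) : q`_i = b i by rewrite coef_poly ltn_ord valK.
have rq : root (map_poly f q) x.
  rewrite rootE (@horner_coef_wide _ d) ?size_map_poly ?size_poly //.
  set y := \sum_(i < d) _; suff : y ^+ p == 0 by rewrite expf_eq0 => /andP[].
  rewrite -(pFrobenius_autE cp) rmorph_sum /= -[eqbRHS]s0; apply/eqP.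
  apply: eq_bigr => i _; rewrite pFrobenius_autE coef_map qE exprMn -rmorphXn hb.
  by rewrite -exprM mulnC.
have q0 : q = 0.
  apply/eqP/negPn/negP => q0; have := dvdp_leq q0 (mdiv _ rq).
  by rewrite sd ltnNge size_poly.
have b0 i : b i = 0 by rewrite -qE q0 coef0.
case: (unliftP ord0 i0) ai0 => [j ->|->]; last by rewrite a0 eqxx.
by rewrite -hb b0 expr0n eqn0Ngt (prime_gt0 (pcharf_prime cp)) eqxx.
Qed.

(** * Unramified extensions inside the algebraic closure *)

(** The exponents q are 1 and the powers of the characteristic exponent. *)
Lemma pnat_root_closed (k l : fieldType) (f : {rmorphism k -> l}) q (E : l -> Prop) x :
  perfect_field k -> GRing.closed_field_axiom l -> algebraic_ext f ->
  [pchar l].-nat q -> (forall c, E (f c)) ->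
  (forall y z, E y -> E z -> E (y - z)) -> (forall y z, E y -> E z -> E (y * z)) ->
  E (x ^+ q) -> E x.
Proof.
move=> perf lC falg + Ec EB EM; have [n] := ubnP q.
elim: n q => // n IH q; rewrite ltnS => qn hq; have q0 : (0 < q)%N by case/andP: hq.
have [q1|q1] := leqP q 1.
  by rewrite (@anti_leq q 1) ?expr1 // q1 q0.
have [p pr_p pq] := pdivP q1.
have cp : p \in [pchar l].
  by apply: (pnatPpi hq); rewrite mem_primes pr_p q0.
rewrite -(divnK pq) exprM => /(pth_root_closed perf lC falg cp Ec EB EM).
apply: IH; last by apply: pnat_dvd hq; apply: dvdn_div.
by apply: leq_trans qn; rewrite ltn_Pdiv ?prime_gt1 // q0.
Qed.

Section Unramified.
Variables (k H L : fieldType) (vh : valuation H) (w : valuation L).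
Variables (j : {rmorphism H -> L}) (W : valuation_ring L).
Variable kap : {rmorphism k -> residue_field W}.
Hypotheses (Ww : is_ring_of W w) (jw : extends_valuation j vh w).
Hypotheses (lC : GRing.closed_field_axiom L) (jalg : algebraic_ext j).
Hypothesis vhZ : forall x, x != 0 -> ord vh x \is a Num.int.
Hypotheses (perf : perfect_field k) (kalg : algebraic_ext kap).
Hypothesis kinf : ~ finite_degree kap.
Hypothesis kap_lift : forall c, exists2 x, vge vh 0 x & kap c = res W (j x).
Hypothesis kap_res : forall x, vge vh 0 x -> exists c, kap c = res W (j x).
(* L is residually algebraic over H, with the coefficients of the equation lifted
   to H. *)
Hypothesis rel : forall y, vge w 0 y -> exists P : {poly H},
  [/\ forall i, vge vh 0 P`_i, exists i, ~~ vgt vh 0 P`_i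
    & vgt w 0 (map_poly j P).[y]].

(** A subring that contains H is a subfield, as shown below. Finite residual degree,
    the last clause, is what leaves a new residue available at each step. *)
Record unramified (S : L -> Prop) : Prop := Unramified {
  unr_cst : forall c, S (j c);
  unr_sub : forall x y, S x -> S y -> S (x - y);
  unr_mul : forall x y, S x -> S y -> S (x * y);
  unr_int : forall x, S x -> x != 0 -> ord w x \is a Num.int;
  unr_fin : exists (I : finType) (b : I -> residue_field W), forall x, S x ->
    vge w 0 x -> exists c : I -> k, res W x = \sum_i kap (c i) * b i
}.

Section Ops.
Variables (S : L -> Prop) (Su : unramified S).

Lemma unr0 : S 0. Proof. by rewrite -(rmorph0 j); apply: (unr_cst Su). Qed.
Lemma unr1 : S 1. Proof. by rewrite -(rmorph1 j); apply: (unr_cst Su). Qed.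
Lemma unrN x : S x -> S (- x).
Proof. by move=> hx; rewrite -sub0r; apply: (unr_sub Su) => //; apply: unr0. Qed.
Lemma unrD x y : S x -> S y -> S (x + y).
Proof. by move=> hx hy; rewrite -[y]opprK; apply: (unr_sub Su) => //; apply: unrN. Qed.
Lemma unrX x n : S x -> S (x ^+ n).
Proof.
move=> hx; elim: n => [|n IH]; first exact: unr1.
by rewrite exprS; apply: (unr_mul Su).
Qed.
Lemma unr_sum (I : Type) (r : seq I) (P : pred I) (G : I -> L) :
  (forall i, P i -> S (G i)) -> S (\sum_(i <- r | P i) G i).
Proof. by move=> h; elim/big_ind: _ => //; [apply: unr0 | apply: unrD]. Qed.

Lemma unr_horner (h : {poly L}) x : (forall i, S h`_i) -> S x -> S h.[x].
Proof.
move=> hh hx; rewrite horner_coef; apply: unr_sum => i _.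
by apply: (unr_mul Su) => //; apply: unrX.
Qed.

(** As x is algebraic over H, its inverse is a polynomial in x over H. *)
Lemma unrV x : S x -> S x^-1.
Proof.
move=> hx; have [->|x0] := eqVneq x 0; first by rewrite invr0; apply: unr0.
have [p [[p1 ip] rp pdiv]] := algebraic_min (jalg x).
have [q [a pqa]] : exists q a, p = q * 'X + a%:P.
  elim/poly_ind: p {p1 ip rp pdiv} => [|q a _]; last by exists q, a.
  by exists 0, 0; rewrite mul0r addr0.
have [a0|a0] := eqVneq a 0.
  exfalso; move: rp; rewrite pqa a0 addr0 rmorphM rootM /= map_polyX orbC.
  rewrite rootE hornerX (negbTE x0) /= => /pdiv; rewrite pqa a0 addr0 => d.
  have q0 : q != 0 by apply: contraTneq p1 => q0; rewrite pqa q0 a0 mul0r addr0 size_poly0.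
  by have := dvdp_leq q0 d; rewrite size_mulX // ltnn.
have ja : j a != 0 by rewrite fmorph_eq0.
have -> : x^-1 = - (map_poly j q).[x] * j a^-1.
  move: rp; rewrite pqa rootE rmorphD rmorphM /= map_polyX map_polyC !hornerE addr_eq0.
  move=> /eqP h; apply: (mulfI x0); rewrite divff // fmorphV mulrA mulrN [x * _]mulrC h.
  by rewrite opprK divff.
apply: (unr_mul Su); last exact: (unr_cst Su).
by apply: unrN; apply: unr_horner => // i; rewrite coef_map; apply: (unr_cst Su).
Qed.

(** Discard the leading coefficients of positive valuation, then divide by the
    first one that is a unit. *)
Lemma unr_monic (h : {poly L}) t : vge w 0 t ->
  (forall i, S h`_i) -> (forall i, vge w 0 h`_i) -> (exists i, ~~ vgt w 0 h`_i) ->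
  vgt w 0 h.[t] -> exists G : {poly L}, [/\ G \is monic, (size G <= size h)%N,
    forall i, S G`_i, forall i, vge w 0 G`_i & vgt w 0 G.[t]].
Proof.
move=> ht; have [n] := ubnP (size h); elim: n h => // n IH h.
rewrite ltnS => sn hS h0 hu hp.
have [ld|ld] := boolP (vgt w 0 (lead_coef h)); last first.
  have [l0 lo] := unit_ord (h0 _) ld.
  have lV : vge w 0 (lead_coef h)^-1 by rewrite vge_ord // ordV // lo oppr0.
  exists ((lead_coef h)^-1 *: h); split.
  - by rewrite monicE lead_coefZ mulVf.
  - exact: size_scale_leq.
  - by move=> i; rewrite coefZ; apply: (unr_mul Su) => //; apply: unrV; apply: hS.
  - by move=> i; rewrite coefZ vgeM0.
  - by rewrite hornerZ vgtMr.
have h00 : h != 0.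
  by apply/eqP => e; case: hu => i; rewrite e coef0 vgt0.
pose g := h - lead_coef h *: 'X^((size h).-1).
have gE i : g`_i = if i == (size h).-1 then 0 else h`_i.
  rewrite coefB coefZ coefXn; case: eqP => [->|_]; rewrite ?mulr1 ?subrr //.
  by rewrite mulr0 subr0.
have sg : (size g < size h)%N.
  rewrite -(prednK (n := size h)) ?size_poly_gt0 // ltnS.
  apply/leq_sizeP => i hi; rewrite gE; case: eqP => // /eqP ne.
  by rewrite nth_default // (leq_trans (leqSpred _)) // ltn_neqAle eq_sym ne.
have [|||||G [G1 G2 G3 G4 G5]] := IH g.
- exact: leq_trans sg sn.
- by move=> i; rewrite gE; case: ifP => // _; apply: unr0.
- by move=> i; rewrite gE; case: ifP.
- by case: hu => i hi; exists i; rewrite gE; case: eqP => // ei; case/negP: hi; rewrite ei.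
- by rewrite hornerD hornerN hornerZ hornerXn vgtB // vgtMl ?vgeX0.
by exists G; split=> //; apply: leq_trans G2 (ltnW sg).
Qed.

End Ops.

Lemma unramified_base : unramified (fun y => exists c, y = j c).
Proof.
split.
- by move=> c; exists c.
- by move=> _ _ [a ->] [b ->]; exists (a - b); rewrite rmorphB.
- by move=> _ _ [a ->] [b ->]; exists (a * b); rewrite rmorphM.
- by move=> _ [a ->]; rewrite fmorph_eq0 (ord_ext _ jw); apply: vhZ.
exists 'I_1, (fun=> 1) => _ [a ->]; rewrite (vge_ext _ _ jw) => /kap_res[c hc].
by exists (fun=> c); rewrite big_ord1 mulr1.
Qed.

(** Let th be a residue that does not come from S, and G a monic polynomial over S of
    least degree that vanishes at th modulo the maximal ideal. A root r of G with
    residue th generates an extension of S without ramification: by minimality of the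
    degree of G, the value of h.[r] is the least value of a coefficient of h when h
    has smaller degree. The residue field becomes that of S with th adjoined, still
    finite over k. *)
Lemma unramified_step S : unramified S -> exists S' r,
  [/\ unramified S', forall x, S x -> S' x, S' r, vge w 0 r &
    forall q s, [pchar residue_field W].-nat q -> S s -> vge w 0 s ->
      ~~ vgt w 0 (r ^+ q - s)].
Proof.
move=> Su; have [I [b hb]] := unr_fin Su.
pose E x := exists s, [/\ S s, vge w 0 s & x = res W s].
have [th nth] : exists th, ~ E th.
  apply/existsNP => hE; apply: kinf.
  apply: (@dependent_finite_degree _ _ _ #|I|.+1) => u.
  apply: (@dependent_span _ _ _ _ b) => // i.
  by have [s [Ss s0 ->]] := hE (u i); apply: hb.
have [t t0 tth] := res_surj Ww th.
pose rel_deg n := exists G : {poly L}, [/\ G \is monic, size G = n.+1,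
  forall i, S G`_i, forall i, vge w 0 G`_i & vgt w 0 G.[t]].
have mono (h : {poly L}) : (forall i, S h`_i) -> (forall i, vge w 0 h`_i) ->
    (exists i, ~~ vgt w 0 h`_i) -> vgt w 0 h.[t] ->
    exists2 n, (n < size h)%N & rel_deg n.
  move=> h1 h2 h3 h4; have [G [mG sG G1 G2 G3]] := unr_monic Su t0 h1 h2 h3 h4.
  have sG0 : (0 < size G)%N by rewrite size_poly_gt0 monic_neq0.
  exists (size G).-1; first by rewrite prednK.
  by exists G; split; rewrite ?prednK.
have : exists n, `[< rel_deg n >].
  have [P [P1 [i P2] P3]] := rel t0.
  have [||||n _ hn] := mono (map_poly j P) => //; last by exists n; apply/asboolP.
  - by move=> a; rewrite coef_map; apply: (unr_cst Su).
  - by move=> a; rewrite coef_map (vge_ext _ _ jw).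
  - by exists i; rewrite coef_map (vgt_ext _ _ jw).
case/ex_minnP => N /asboolP[G [mG sG GS G0 Gt]] Nmin.
have {}mono (h : {poly L}) : (size h <= N)%N -> (forall i, S h`_i) ->
    (forall i, vge w 0 h`_i) -> (exists i, ~~ vgt w 0 h`_i) -> ~~ vgt w 0 h.[t].
  move=> sh h1 h2 h3; apply/negP => h4; have [n n1] := mono h h1 h2 h3 h4.
  by move=> /asboolP/Nmin; rewrite leqNgt (leq_trans n1 sh).
have [r Gr rt] : exists2 r, root G r & vgt w 0 (t - r).
  have [s Gs] := closed_split lC mG.
  have [r rs rt] : exists2 r, r \in s & vgt w 0 (t - r).
    move: Gt; rewrite Gs horner_prod; elim: (s) => [|z s' IH].
      by rewrite big_nil vgt1.
    rewrite big_cons hornerXsubC.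
    have [tz _|tz] := boolP (vgt w 0 (t - z)).
      by exists z; rewrite ?inE ?eqxx.
    have tz0 := notvgt_neq0 tz.
    have tzo : ord w (t - z) <= 0.
      by move: tz; rewrite /vgt (negbTE tz0) /= -leNgt.
    move=> hp; have [|r rs rt] := IH; last by exists r => //; rewrite inE rs orbT.
    rewrite -[X in vgt _ _ X](mulKf tz0) -[0]addr0 mulrC vgtM //.
    by rewrite vge_ord // ordV // oppr_ge0.
  by exists r => //; rewrite Gs root_prod_XsubC.
have r0 : vge w 0 r by rewrite -(vge_congr (vgt_vge rt)).
have rth : res W r = th.
  by rewrite tth; apply/eqP; rewrite eq_sym (res_eq Ww).
(* The degree N of G is positive. *)
have size1 (c : L) : (size c%:P <= N)%N.
  apply: leq_trans (size_polyC_leq1 c) _; rewrite lt0n; apply/eqP => N0.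
  move: Gt; rewrite N0 in sG; have /size_poly1P[a _ Ga] := introT eqP sG.
  by move: mG; rewrite Ga monicE lead_coefC hornerC => /eqP ->; rewrite vgt1.
have ortho (h : {poly L}) : h != 0 -> (size h <= N)%N -> (forall i, S h`_i) ->
    exists i, [/\ h`_i != 0, forall a, vge w (ord w h`_i) h`_a, h.[r] != 0 &
      ord w h.[r] = ord w h`_i].
  move=> h0 sh hS; have [i [hi hmin]] := min_coef w h0.
  pose h' := (h`_i)^-1 *: h.
  have h'0 a : vge w 0 h'`_a.
    by rewrite coefZ -(addNr (ord w h`_i)) vgeM // vge_ord // ordV.
  have nt : ~~ vgt w 0 h'.[t].
    apply: mono => //; first exact: leq_trans (size_scale_leq _ _) sh.
      by move=> a; rewrite coefZ; apply: (unr_mul Su) => //; apply: (unrV Su).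
    by exists i; rewrite coefZ mulVf // vgt1.
  have nr : ~~ vgt w 0 h'.[r] by rewrite -(vgt_congr (vgt_horner h'0 t0 r0 rt)).
  have [hr0 hro] := unit_ord (vge_horner h'0 r0) nr.
  have e : h.[r] = h`_i * h'.[r] by rewrite hornerZ mulVKf.
  exists i; split=> //; first by rewrite e mulf_neq0.
  by rewrite e ordM // hro addr0.
have reduce (h : {poly L}) : (forall i, S h`_i) -> exists h' : {poly L},
    [/\ (size h' <= N)%N, forall i, S h'`_i & h.[r] = h'.[r]].
  have [n] := ubnP (size h); elim: n h => // n IH h; rewrite ltnS => sn hS.
  have [sh|sh] := leqP (size h) N; first by exists h.
  have h0 : h != 0 by rewrite -size_poly_gt0 (leq_ltn_trans _ sh).
  pose g := h - (lead_coef h *: 'X^((size h).-1 - N)) * G.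
  have sg : (size g < size h)%N.
    have sGh : size (lead_coef h *: 'X^((size h).-1 - N) * G)%R = size h.
      rewrite -scalerAl size_scale ?lead_coef_eq0 // mulrC size_mulXn ?monic_neq0 //.
      have hp : (0 < size h)%N by rewrite size_poly_gt0.
      by rewrite sG addnS subnK ?(prednK hp) // -ltnS (prednK hp).
    rewrite -(prednK (n := size h)) ?size_poly_gt0 // ltnS.
    apply/leq_sizeP => i; rewrite leq_eqVlt => /orP[/eqP <-|hi].
      have := lead_coefE (lead_coef h *: 'X^((size h).-1 - N) * G).
      rewrite sGh lead_coefM lead_coefZ lead_coefXn mulr1 (monicP mG) mulr1 => e.
      by rewrite coefB -e -lead_coefE subrr.
    have hi' : (size h <= i)%N by apply: leq_trans (leqSpred _) hi.
    by rewrite coefB !nth_default ?sGh ?subrr.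
  have [||h' [sh' h'S e]] := IH g.
  - exact: leq_trans sg sn.
  - move=> i; rewrite coefB; apply: (unr_sub Su) => //.
    rewrite -scalerAl coefZ coefXnM; apply: (unr_mul Su); first exact: hS.
    by case: ifP => _ //; apply: (unr0 Su).
  exists h'; split=> //; rewrite -e hornerD hornerN hornerM (eqP Gr) mulr0.
  by rewrite subr0.
pose S' y := exists h : {poly L}, [/\ (size h <= N)%N, forall i, S h`_i & y = h.[r]].
have S'r (h : {poly L}) : (forall i, S h`_i) -> S' h.[r].
  by move=> /reduce[h' [? ? ?]]; exists h'.
have SS' x : S x -> S' x.
  move=> hx; exists x%:P; split=> //; last by rewrite hornerC.
  by move=> i; rewrite coefC; case: ifP => _ //; apply: (unr0 Su).
exists S', r; split=> //; last first.
- move=> q s hq Ss s0; apply/negP => h; apply: nth; rewrite -rth.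
  apply: (pnat_root_closed perf (residue_closed Ww lC) kalg hq).
  + move=> c; have [x x0 ->] := kap_lift c; exists (j x); split=> //.
      exact: (unr_cst Su).
    by rewrite (vge_ext _ _ jw).
  + move=> _ _ [a [Sa a0 ->]] [a' [Sa' a0' ->]]; exists (a - a'); split.
    * exact: (unr_sub Su).
    * exact: vgeB.
    * by rewrite (resB Ww).
  + move=> _ _ [a [Sa a0 ->]] [a' [Sa' a0' ->]]; exists (a * a'); split.
    * exact: (unr_mul Su).
    * exact: vgeM0.
    * by rewrite (resM Ww).
  by exists s; split=> //; rewrite -(resX Ww) //; apply/eqP; rewrite (res_eq Ww) ?vgeX0.
- rewrite -[r](hornerX r) -[X in S' X]/('X.[r]); apply: S'r => i.
  by rewrite coefX -(rmorph_nat j); apply: (unr_cst Su).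
split.
- by move=> c; apply: SS'; apply: (unr_cst Su).
- move=> _ _ [h [sh hS ->]] [g [sg gS ->]]; rewrite -hornerN -hornerD; apply: S'r => i.
  by rewrite coefB; apply: (unr_sub Su).
- move=> _ _ [h [sh hS ->]] [g [sg gS ->]]; rewrite -hornerM; apply: S'r => i.
  by rewrite coefM; apply: (unr_sum Su) => a _; apply: (unr_mul Su).
- move=> _ [h [sh hS ->]] hr; have h0 : h != 0.
    by apply: contraNneq hr => ->; rewrite horner0.
  have [i [hi _ _ ->]] := ortho h h0 sh hS; exact: (unr_int Su).
exists ('I_N * I)%type, (fun il : 'I_N * I => b il.2 * th ^+ il.1) => _ [h [sh hS ->]] hr.
have h0 a : vge w 0 h`_a.
  have [->|hn0] := eqVneq h 0; first by rewrite coef0.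
  have [i [hi hmin hr0 hro]] := ortho h hn0 sh hS.
  apply: vge_le (hmin a); rewrite -hro; move: hr.
  by rewrite /vge (negbTE hr0).
have /choice[c hc] a := hb _ (hS a) (h0 a).
exists (fun il : 'I_N * I => c il.1 il.2).
rewrite -(pair_bigA _ (fun (a : 'I_N) (l : I) => kap (c a l) * (b l * th ^+ a))) /=.
rewrite (horner_coef_wide _ sh) (res_sum Ww) => [|i _]; last by rewrite vgeM0 ?vgeX0.
apply: eq_bigr => i _; rewrite (resM Ww) ?vgeX0 // (resX Ww) // rth hc mulr_suml.
by apply: eq_bigr => l _; rewrite mulrA.
Qed.

Lemma unramified_sequence : exists (S : nat -> L -> Prop) (a : nat -> L), forall n,
  [/\ unramified (S n), forall x, S n x -> S n.+1 x, S n.+1 (a n), vge w 0 (a n) &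
    forall q s, [pchar residue_field W].-nat q -> S n s -> vge w 0 s ->
      ~~ vgt w 0 (a n ^+ q - s)].
Proof.
have /choice[next hnext] : forall S : {S | unramified S},
    exists T : {S | unramified S} * L,
    [/\ forall x, sval S x -> sval T.1 x, sval T.1 T.2, vge w 0 T.2 &
      forall q s, [pchar residue_field W].-nat q -> sval S s -> vge w 0 s ->
      ~~ vgt w 0 (T.2 ^+ q - s)].
  move=> [S Su]; have [S' [r [Su' SS' S'r r0 hr]]] := unramified_step Su.
  by exists (exist _ S' Su', r).
pose st n := iter n (fun S => (next S).1) (exist _ _ unramified_base).
exists (fun n => sval (st n)), (fun n => (next (st n)).2) => n.
by have [? ? ? ?] := hnext (st n); split=> //; apply: (svalP (st n)).
Qed.

End Unramified.

(** * A limit of unramified elements that is transcendental *)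

Lemma horner_lipschitz (F : fieldType) (w : valuation F) (p : {poly F}) :
  exists c, forall x h, vge w 0 x -> vge w 0 h ->
    exists2 r, vge w c r & p.[x + h] = p.[x] + h * r.
Proof.
have [c hc] := horner_taylor2 w p; have [d hd] := horner_bound w p^`().
exists (Num.min c d) => x h hx hh; have [r hr ->] := hc x h hx hh.
exists (p^`().[x] + h * r); last by ring.
apply: vgeD; first by apply: vge_le (hd x hx); rewrite ge_min lexx orbT.
apply: vge_le (_ : vge w (0 + c) _); last exact: vgeM.
by rewrite add0r ge_min lexx.
Qed.

Lemma res_nat (F : fieldType) (W : valuation_ring F) (w : valuation F) n :
  is_ring_of W w -> res W n%:R = n%:R.
Proof.
move=> Ww; have n0 m : vge w 0 (m%:R : F).
  by elim: m => [|m IH]; rewrite ?vge0 // -addn1 natrD vgeD.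
elim: n => [|n IH]; first exact: (res0 Ww).
by rewrite -addn1 !natrD (resD Ww) // IH (res1 Ww).
Qed.

Lemma residue_pnat (F : fieldType) (W : valuation_ring F) (w : valuation F) q :
  is_ring_of W w -> [pchar F].-nat q -> [pchar residue_field W].-nat q.
Proof.
move=> Ww; apply: sub_in_pnat => p _; rewrite !inE => /andP[-> /eqP p0] /=.
by rewrite -(res_nat p Ww) p0 (res0 Ww).
Qed.

Lemma deriv0_pchar (F : fieldType) (Q : {poly F}) : (1 < size Q)%N -> Q^`() = 0 ->
  exists p (R : {poly F}), [/\ p \in [pchar F], (size R < size Q)%N & Q = R \Po 'X^p].
Proof.
move=> sQ dQ; have Qc i : Q`_i *+ i = 0.
  by case: i => [|i] //; rewrite -coef_deriv dQ coef0.
have Q0 : Q != 0 by rewrite -size_poly_gt0 ltnW.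
have m0 : (0 < (size Q).-1)%N by rewrite -ltnS prednK // ltnW.
have [p cp] : exists p, p \in [pchar F].
  apply: (natf0_pchar m0).
  have /eqP : lead_coef Q * (size Q).-1%:R = 0 by rewrite mulr_natr; apply: Qc.
  by rewrite mulf_eq0 lead_coef_eq0 (negbTE Q0).
have p1 := prime_gt1 (pcharf_prime cp).
exists p, (\poly_(i < (size Q).-1) Q`_(i * p)%N); split=> //.
  by apply: leq_ltn_trans (size_poly _ _) _; rewrite prednK // ltnW.
apply/polyP => i; rewrite coef_comp_poly_Xn ?(ltnW p1) //; case: ifP => pi.
  rewrite coef_poly divnK //; case: ltnP => // hi.
  rewrite nth_default // -(divnK pi); apply: leq_trans (leq_mul hi p1).
  by move: sQ; case: (size Q) => [|[|m]] //= _; rewrite muln2 doubleS !ltnS -addnn leq_addr.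
have /eqP : Q`_i * i%:R = 0 by rewrite mulr_natr; apply: Qc.
rewrite mulf_eq0 => /orP[/eqP //|].
by rewrite -(dvdn_pcharf cp) pi.
Qed.

Section Limit.
Variables (k H L : fieldType) (vh : valuation H) (w : valuation L).
Variables (j : {rmorphism H -> L}) (W : valuation_ring L).
Variable kap : {rmorphism k -> residue_field W}.
Hypotheses (Ww : is_ring_of W w) (jw : extends_valuation j vh w).
Hypotheses (jalg : algebraic_ext j).
Variables (up : H) (S : nat -> L -> Prop) (a : nat -> L).
Hypotheses (up0 : up != 0) (upv : ord vh up = 1).
Hypothesis Sa : forall n,
  [/\ unramified w j kap (S n), forall x, S n x -> S n.+1 x, S n.+1 (a n),
    vge w 0 (a n) & forall q s, [pchar residue_field W].-nat q -> S n s ->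
      vge w 0 s -> ~~ vgt w 0 (a n ^+ q - s)].

Definition partial_sum n := \sum_(i < n) a i * j up ^+ i.

Let Su n : unramified w j kap (S n). Proof. by case: (Sa n). Qed.
Let a0 n : vge w 0 (a n). Proof. by case: (Sa n). Qed.

Let ju0 : j up != 0. Proof. by rewrite fmorph_eq0. Qed.
Let juo n : ord w (j up ^+ n) = n%:R.
Proof. by rewrite ordX // (ord_ext _ jw) upv. Qed.
Let vju (n : nat) : vge w n%:R (j up ^+ n). Proof. by rewrite vge_ord // juo. Qed.

Lemma partial_sum_in n : S n (partial_sum n).
Proof.
have mono i m x : S i x -> S (i + m)%N x.
  elim: m => [|m IH] h; rewrite ?addn0 // addnS.
  by case: (Sa (i + m)%N) => _ + _ _ _; apply; apply: IH.
rewrite /partial_sum; apply: (unr_sum (Su n)) => i _; apply: (unr_mul (Su n)).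
  have := mono i.+1 (n - i.+1)%N (a i); rewrite subnKC ?ltn_ord //.
  by apply; case: (Sa i).
exact: (unrX (Su n)) (unr_cst (Su n) _).
Qed.

Lemma partial_sum_int n : vge w 0 (partial_sum n).
Proof.
apply: vge_sum => i _; rewrite vgeM0 //.
by apply: vge_le (vju i); rewrite ler0n.
Qed.

Lemma partial_sumS n : partial_sum n.+1 = partial_sum n + a n * j up ^+ n.
Proof. by rewrite /partial_sum big_ord_recr. Qed.

(** All elements of L are algebraic over H. Take Q of least degree among the equations
    over H of the powers x ^+ q, with q a power of the characteristic exponent; its
    derivative does not vanish at x ^+ q. With b the n-th partial sum and e = x ^+ q - b ^+ q,
    Taylor's formula gives 0 = Q(b ^+ q) + Q'(b ^+ q) e up to an error of order e ^ 2.
    Since e is up ^ (n q) a_n ^+ q up to higher order, for n large the residue of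
    a_n ^+ q is that of - Q(b ^+ q) / (Q'(b ^+ q) up ^ (n q)), an element of S n. *)
Lemma limit_not_algebraic x : ~ forall n : nat, vge w n%:R (x - partial_sum n).
Proof.
move=> xlim; have x0 : vge w 0 x.
  by have := xlim 0; rewrite /partial_sum big_ord0 subr0.
pose rel N := exists q (Q : {poly H}), [/\ [pchar L].-nat q, Q != 0, size Q = N &
  root (map_poly j Q) (x ^+ q)].
have : exists N, `[< rel N >].
  by have [Q Q0 rQ] := jalg x; exists (size Q); apply/asboolP; exists 1, Q; rewrite expr1.
case/ex_minnP => N /asboolP[q [Q [hq Q0 sQ rQ]]] Nmin.
have q0 : (0 < q)%N by case/andP: hq.
have dQ : Q^`() != 0.
  apply/eqP => dQ; have sQ1 : (1 < size Q)%N.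
    have := root_size_gt1 (p := map_poly j Q) _ rQ.
    by rewrite map_poly_eq0 size_map_poly; apply.
  have [p [R [cp sR QR]]] := deriv0_pchar sQ1 dQ.
  have : (N <= size R)%N.
    apply/Nmin/asboolP; exists (q * p)%N, R; split=> //.
    - by rewrite pnatM hq pnatE ?(pcharf_prime cp) ?(fmorph_pchar j).
    - by apply: contraNneq Q0 => R0; rewrite QR R0 comp_poly0.
    - move: rQ; rewrite QR map_comp_poly map_polyXn !rootE horner_comp hornerXn.
      by rewrite exprM.
  by rewrite leqNgt -sQ sR.
have dg : (map_poly j Q)^`().[x ^+ q] != 0.
  apply/negP => /eqP dg; have : (N <= size Q^`())%N.
    apply/Nmin/asboolP; exists q, Q^`(); split=> //.
    by rewrite rootE -deriv_map dg.
  by rewrite leqNgt -sQ lt_size_deriv.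
set P := map_poly j Q in rQ dg; set D := ord w P^`().[x ^+ q].
have [c hc] := horner_taylor2 w P; have [d hd] := horner_lipschitz w P^`().
have [n hn] := rat_nat_bound (Num.max (D - c) (D - d) + 1).
have {hn} [nc nd] : D - c < n%:R /\ D - d < n%:R.
  have h1 : D - c <= Num.max (D - c) (D - d) by rewrite le_max lexx.
  have h2 : D - d <= Num.max (D - c) (D - d) by rewrite le_max lexx orbT.
  by split; lra.
pose b := partial_sum n; pose u := (x - b) / j up ^+ n.
have pn0 : j up ^+ n != 0 by rewrite expf_neq0.
have ua : vgt w 0 (u - a n).
  have -> : u - a n = (x - partial_sum n.+1) / j up ^+ n.
    by rewrite /u /b partial_sumS; field.
  apply: (@vge_vgt _ _ 0 1) => //; have -> : (1 : rat) = n.+1%:R - n%:R.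
    by rewrite -natrB // subSnn.
  by rewrite vgeM // vge_ord // ordV // juo.
have u0 : vge w 0 u by rewrite (vge_congr (vgt_vge ua)).
pose e := x ^+ q - b ^+ q.
have eE : e = j up ^+ (n * q) * u ^+ q.
  have -> : e = (x - b) ^+ q.
    have := exprDn_pchar (x - b) b hq; rewrite subrK => h.
    by rewrite /e h addrK.
  by rewrite exprM -exprMn /u mulrC divfK.
have nq : vge w n%:R (j up ^+ (n * q)).
  by apply: vge_le (vju _); rewrite ler_nat leq_pmulr.
have en : vge w n%:R e by rewrite eE -[n%:R]addr0 vgeM // vgeX0.
have e0 : vge w 0 e by apply: vge_le en; rewrite ler0n.
have b0 : vge w 0 (b ^+ q) by rewrite vgeX0 // partial_sum_int.
have xqE : x ^+ q = b ^+ q + e by rewrite /e addrC subrK.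
have [r hr Pr] := hc _ _ b0 e0; have [r' hr' Pr'] := hd _ _ b0 e0.
rewrite -xqE (eqP rQ) in Pr; rewrite -xqE in Pr'.
have [db0 dbD] : P^`().[b ^+ q] != 0 /\ ord w P^`().[b ^+ q] = D.
  have -> : P^`().[b ^+ q] = P^`().[x ^+ q] + (- (e * r')) by rewrite Pr' addrK.
  apply: vgt_dom => //; rewrite vgtN; apply: vge_vgt (vgeM en hr').
  by rewrite -/D; lra.
have pq0 : j up ^+ (n * q) != 0 by rewrite expf_neq0.
pose s := - P.[b ^+ q] / (P^`().[b ^+ q] * j up ^+ (n * q)).
have sU : vgt w 0 (u ^+ q - s).
  have -> : u ^+ q - s = - (j up ^+ (n * q) * (u ^+ q) ^+ 2 * r / P^`().[b ^+ q]).
    have hP : P.[b ^+ q] = - (P^`().[b ^+ q] * e + e ^+ 2 * r).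
      by apply/eqP; rewrite -addr_eq0 addrA; apply/eqP/esym.
    by rewrite /s hP eE; field; rewrite db0 pq0.
  rewrite vgtN; apply: (@vge_vgt _ _ 0 (n%:R + 0 + c - D)); first by lra.
  apply: vgeM; last by rewrite vge_ord // ordV // dbD.
  by apply: vgeM => //; apply: vgeM => //; rewrite !vgeX0.
have s0 : vge w 0 s by rewrite -(vge_congr (vgt_vge sU)) vgeX0.
have Sb : S n (b ^+ q) by apply: (unrX (Su n)) (partial_sum_in n).
have SP (R : {poly H}) : S n (map_poly j R).[b ^+ q].
  apply: (unr_horner (Su n)) => // i; rewrite coef_map; exact: (unr_cst (Su n)).
have Ss : S n s.
  apply: (unr_mul (Su n)); first exact: (unrN (Su n)) (SP Q).
  apply: (unrV jalg (Su n)); apply: (unr_mul (Su n)).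
    by rewrite /P deriv_map; apply: SP.
  by apply: (unrX (Su n)) (unr_cst (Su n) _).
have [_ _ _ _ /(_ q s (residue_pnat Ww hq) Ss s0)/negP[]] := Sa n.
rewrite -(subrK (u ^+ q) (a n ^+ q)) -addrA vgtD //.
by rewrite vgtXB // -vgtN opprB.
Qed.

(** Values of polynomials at a limit of the partial sums are values of
    polynomials at the partial sums, hence lie in the value group of the base. *)
Lemma limit_order_int (C : fieldType) (vC : valuation C) (g : {rmorphism L -> C})
    alpha (p : {poly H}) : extends_valuation g w vC ->
  (forall n : nat, vge vC n%:R (alpha - g (partial_sum n))) ->
  (map_poly (g \o j) p).[alpha] != 0 ->
  ord vC (map_poly (g \o j) p).[alpha] \is a Num.int.
Proof.
move=> gw lim; set P := map_poly _ p => P0.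
have [c hc] := horner_lipschitz vC P.
have [n hn] := rat_nat_bound (ord vC P.[alpha] - c + 1).
have b0 : vge vC 0 (g (partial_sum n)) by rewrite (vge_ext _ _ gw) partial_sum_int.
have h0 : vge vC 0 (alpha - g (partial_sum n)) by apply: vge_le (lim n); rewrite ler0n.
have [r hr] := hc _ _ b0 h0; rewrite addrC subrK => Pa.
have Pb : P.[g (partial_sum n)] = g (map_poly j p).[partial_sum n].
  by rewrite /P map_poly_comp horner_map.
have [Pb0 Pbo] : P.[g (partial_sum n)] != 0 /\ ord vC P.[g (partial_sum n)] = ord vC P.[alpha].
  have -> : P.[g (partial_sum n)] = P.[alpha] + - ((alpha - g (partial_sum n)) * r).
    by rewrite Pa addrK.
  by apply: vgt_dom => //; rewrite vgtN; apply: vge_vgt (vgeM (lim n) hr); lra.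
rewrite -Pbo Pb (ord_ext _ gw); apply: (unr_int (Su n)).
  apply: (unr_horner (Su n)); last exact: partial_sum_in.
  by move=> i; rewrite coef_map; apply: (unr_cst (Su n)).
by move: Pb0; rewrite Pb fmorph_eq0.
Qed.

End Limit.

(** * Evaluation of rational functions *)

Lemma ratfun_frac (K : fieldType) (phi : ratfun K) :
  exists (p q : {poly K}), q != 0 /\ phi = tofrac p / tofrac q.
Proof.
have d0 : \d_(repr phi) != 0 by exact: denom_ratioP.
exists (\n_(repr phi)), (\d_(repr phi)); split=> //.
apply: (canRL (mulfK _)); first by rewrite tofrac_eq0.
rewrite -[X in X * _]reprK; apply/eqP.
by rewrite !piE /= FracField.equivfE /FracField.mulf
  !(numden_Ratio, oner_eq0, mulf_neq0) ?oner_eq0 ?mulr1 ?mul1r // mulrC.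
Qed.

Section Eval.
Variables (K C : fieldType) (f : {rmorphism K -> C}) (alpha : C).
Hypothesis tr : ~ algebraicOver f alpha.

Lemma eval_neq0 (p : {poly K}) : p != 0 -> (map_poly f p).[alpha] != 0.
Proof. by move=> p0; apply/negP => rp; apply: tr; exists p. Qed.

Lemma ratfun_eval_morph :
  exists ev : {rmorphism ratfun K -> C}, ev =1 ratfun_eval f alpha.
Proof.
apply: rmorphism_of => [x y||x y].
- have [p [q [q0 ->]]] := ratfun_frac x; have [r [s [s0 ->]]] := ratfun_frac y.
  have -> : tofrac p / tofrac q - tofrac r / tofrac s =
      tofrac (p * s - r * q) / tofrac (q * s) :> ratfun K.
    by rewrite -mulNr addf_div ?tofrac_eq0 // tofracB !tofracM mulNr.
  rewrite !ratfun_evalE ?mulf_neq0 // rmorphB !rmorphM !hornerE.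
  by field; rewrite !eval_neq0.
- rewrite -[1 in LHS]divr1 -(rmorph1 (@tofrac {poly K})) ratfun_evalE ?oner_eq0 //.
  by rewrite rmorph1 hornerC divr1.
- have [p [q [q0 ->]]] := ratfun_frac x; have [r [s [s0 ->]]] := ratfun_frac y.
  have -> : tofrac p / tofrac q * (tofrac r / tofrac s) =
      tofrac (p * r) / tofrac (q * s) :> ratfun K.
    by rewrite mulf_div !tofracM.
  by rewrite !ratfun_evalE ?mulf_neq0 // !rmorphM !hornerM mulf_div.
Qed.

Lemma ratfun_eval_poly (p : {poly K}) :
  ratfun_eval f alpha (tofrac p) = (map_poly f p).[alpha].
Proof.
rewrite -[tofrac p]divr1 -(rmorph1 (@tofrac {poly K})) ratfun_evalE ?oner_eq0 //.
by rewrite rmorph1 hornerC divr1.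
Qed.
End Eval.

Section Pullback.
Variables (F L : fieldType) (h : {rmorphism F -> L}) (w : valuation L).
Fact pullback0 : w (h 0) = +oo%E. Proof. by rewrite rmorph0 Defs.val0. Qed.
Fact pullback_fin x : x != 0 -> w (h x) \is a fin_num.
Proof. by move=> x0; rewrite val_fin // fmorph_eq0. Qed.
Fact pullbackM x y : w (h (x * y)%R) = (w (h x) + w (h y))%E.
Proof. by rewrite rmorphM Defs.valM. Qed.
Fact pullbackD x y : (Order.min (w (h x)) (w (h y)) <= w (h (x + y)%R))%E.
Proof. by rewrite rmorphD Defs.valD. Qed.
Definition pullback :=
  @Valuation F (fun x => w (h x)) pullback0 pullback_fin pullbackM pullbackD.
End Pullback.

(** * The three conditions *)

Section Main.
Variables (K : fieldType) (V : valuation_ring K) (v : valuation K).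
Hypotheses (V_DVR : DVR_with_valuation V v)
  (perf : perfect_field (residue_field V)).
Variables (kbar : fieldType) (ik : {rmorphism residue_field V -> kbar}).
Hypothesis kbar_closure : is_algebraic_closure ik.
Variables (H : fieldType) (vh : valuation H) (iK : {rmorphism K -> H}).
Hypothesis cH : is_completion v vh iK.
Variables (L : fieldType) (w : valuation L) (jK : {rmorphism H -> L}).
Hypotheses (L_closure : is_algebraic_closure jK) (jw : extends_valuation jK vh w).
Variables (C : fieldType) (vC : valuation C) (jC : {rmorphism L -> C}).
Hypothesis cC : is_completion w vC jC.

Let emb : {rmorphism K -> C} := jC \o jK \o iK.
Let Vv : is_ring_of V v := DVR_is_ring_of V_DVR.
Let gw : extends_valuation jC w vC := completion_ext cC.
Let iw : extends_valuation iK v vh := completion_ext cH.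
Let ew : extends_valuation emb v vC.
Proof. by move=> x; rewrite /emb /= gw jw iw. Qed.

Lemma algebraic_in_closure (D : fieldType) (f : {rmorphism D -> L}) alpha :
  algebraicOver (jC \o f) alpha -> exists a, alpha = jC a.
Proof.
move=> [p p0 rp]; apply: (closed_sub L_closure.1).
by exists (map_poly f p); rewrite ?map_poly_eq0 // -map_poly_comp.
Qed.

Lemma outside_transcendental alpha : ~ (exists a, alpha = jC a) ->
  ~ algebraicOver emb alpha.
Proof. by move=> na h; apply: na; apply: (algebraic_in_closure (f := jK \o iK)). Qed.

Lemma integral_relation_C y : vge vC 0 y -> exists P : {poly K},
  [/\ forall i, vge v 0 P`_i, exists i, ~~ vgt v 0 P`_i
    & vgt vC 0 (map_poly emb P).[y]].
Proof.
move=> y0; have [a ha] := completion_approx cC y 1.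
have ya : vgt vC 0 (y - jC a) by apply: vge_vgt ha.
have ja0 : vge vC 0 (jC a) by rewrite -(vge_congr (vgt_vge ya)).
have a0 : vge w 0 a by rewrite -(vge_ext _ _ gw).
have [P [P0 P1 Pa]] := integral_relation cH jw (L_closure.2 a) a0.
exists P; split=> //; rewrite (vgt_congr (vgt_horner _ y0 ja0 ya)); last first.
  by move=> i; rewrite coef_map (vge_ext _ _ ew).
have -> : map_poly emb P = map_poly jC (map_poly (jK \o iK) P).
  by rewrite -map_poly_comp.
by rewrite horner_map (vgt_ext _ _ gw).
Qed.

Lemma cond3_cond1 (W : valuation_ring (ratfun K)) :
  extends_ring (ratfun_cst K) V W -> is_DVR W ->
  algebraic_ext (@residue_map _ _ (ratfun_cst K) V W) ->
  ~ finite_degree (@residue_map _ _ (ratfun_cst K) V W) -> ~ finite_degree ik.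
Proof.
move=> VW [u Wu] Walg nfin fik; have Ww := DVR_is_ring_of Wu.
have [h hh] := residue_map_morph Vv Ww VW.
move: Walg nfin; rewrite -(funext hh) => Walg; apply.
exact: (finite_closure perf kbar_closure.1 fik Walg).
Qed.

Lemma cond2_cond3 alpha : ~ (exists a, alpha = jC a) ->
  is_DVR (V_at emb vC alpha) -> exists W : valuation_ring (ratfun K),
    [/\ extends_ring (ratfun_cst K) V W, is_DVR W,
        algebraic_ext (@residue_map _ _ (ratfun_cst K) V W)
      & ~ finite_degree (@residue_map _ _ (ratfun_cst K) V W)].
Proof.
move=> na [u [uZ hu]]; have tr := outside_transcendental na.
have [ev hev] := ratfun_eval_morph tr.
have evp p : ev (tofrac p) = (map_poly emb p).[alpha].
  by rewrite hev ratfun_eval_poly.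
pose wE := pullback ev vC; pose W := ring_of wE.
have Ww : is_ring_of W wE by [].
have evw : extends_valuation ev wE vC by [].
have fw : extends_valuation (ratfun_cst K) v wE.
  by move=> x; rewrite /wE /= evp map_polyC hornerC ew.
have VW := ring_of_extends Vv Ww fw.
have Wu : DVR_with_valuation W u.
  by split=> // x; rewrite -hu Ww -vgeE /= hev.
have Walg : algebraic_ext (@residue_map _ _ (ratfun_cst K) V W).
  move=> y; have [x x0 ->] := res_surj Ww y.
  have [|P [P0 P1 Px]] := integral_relation_C (y := ev x).
    by rewrite (vge_ext _ _ evw).
  apply: (residue_algebraic Vv Ww VW x0 P0 P1).
  rewrite -(vgt_ext _ _ evw) -horner_map -map_poly_comp.
  have -> // : map_poly (ev \o ratfun_cst K) P = map_poly emb P.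
  by apply: eq_map_poly => c /=; rewrite evp map_polyC hornerC.
exists W; split=> //; first by exists u.
move=> fin; have [vZ [up up0 upv]] := normalized_ord V_DVR.1.
have [I [B [B0 gen]]] := residual_generators Vv Ww fw up0 upv Wu fin.
have gh x : (jC \o jK) (iK x) = ev (ratfun_cst K x).
  by rewrite /= evp map_polyC hornerC.
have gvh : extends_valuation (jC \o jK) vh vC by move=> x; rewrite /= gw jw.
have span := complete_span cH gvh evw gh up0 upv fw B0 gen.
have [] : dependent (jC \o jK) (fun i : 'I_#|I|.+1 => alpha ^+ i).
  apply: (@dependent_span _ _ (jC \o jK) I (fun i => ev (B i))) => // i.
  have evX : ev (tofrac 'X) = alpha by rewrite evp map_polyX hornerX.
  by have [c hc] := span (tofrac 'X ^+ i); exists c; rewrite -hc rmorphXn evX.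
move=> a0 ha; have [p [p0 _ rp]] := dependent_powers (ex_intro _ a0 ha).
by apply: na; apply: (algebraic_in_closure (f := jK)); exists p.
Qed.

Lemma cond1_cond2 : ~ finite_degree ik ->
  exists alpha, ~ (exists a, alpha = jC a) /\ is_DVR (V_at emb vC alpha).
Proof.
move=> nik; have [vZ [up up0 upv]] := normalized_ord V_DVR.1.
have vhZ := completion_int cH vZ.
pose W := ring_of w; have Ww : is_ring_of W w by [].
have jiw : extends_valuation (jK \o iK) v w by move=> x; rewrite /= jw iw.
have VW := ring_of_extends Vv Ww jiw.
have [kap hkap] := residue_map_morph Vv Ww VW.
have relK y : vge w 0 y -> exists P : {poly K}, [/\ forall i, vge v 0 P`_i,
    exists i, ~~ vgt v 0 P`_i & vgt w 0 (map_poly (jK \o iK) P).[y]].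
  by move=> y0; apply: (integral_relation cH jw (L_closure.2 y) y0).
have kalg : algebraic_ext kap.
  move=> y; have [x x0 ->] := res_surj Ww y; have [P [P0 P1 Px]] := relK x x0.
  by rewrite (funext hkap); apply: (residue_algebraic Vv Ww VW x0 P0 P1 Px).
have RC := residue_closed Ww L_closure.1.
have kinf : ~ finite_degree kap.
  by move=> fk; apply: nik; apply: (finite_closure perf RC fk kbar_closure.2).
have kres x : vge v 0 x -> kap (res V x) = res W (jK (iK x)).
  by move=> x0; rewrite hkap (residue_mapR Vv VW).
have kap_lift c : exists2 x, vge vh 0 x & kap c = res W (jK x).
  have [x x0 ->] := res_surj Vv c; exists (iK x); last exact: kres.
  by rewrite (vge_ext _ _ iw).
have kap_res x : vge vh 0 x -> exists c, kap c = res W (jK x).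
  move=> x0; have [y hy] := completion_approx cH x 1.
  have xy : vgt vh 0 (x - iK y) by apply: vge_vgt hy.
  have y0 : vge vh 0 (iK y) by rewrite -(vge_congr (vgt_vge xy)).
  exists (res V y); rewrite kres -?(vge_ext _ _ iw) //; apply/eqP; rewrite eq_sym.
  by rewrite (res_eq Ww) ?(vge_ext _ _ jw) // -rmorphB (vgt_ext _ _ jw).
have rel y : vge w 0 y -> exists P : {poly H}, [/\ forall i, vge vh 0 P`_i,
    exists i, ~~ vgt vh 0 P`_i & vgt w 0 (map_poly jK P).[y]].
  move=> /relK[P [P0 [i P1] Py]]; exists (map_poly iK P); split.
  - by move=> l; rewrite coef_map (vge_ext _ _ iw).
  - by exists i; rewrite coef_map (vgt_ext _ _ iw).
  - by rewrite -map_poly_comp.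
have [S [a Sa]] := unramified_sequence Ww jw L_closure.1 L_closure.2 vhZ perf
  kalg kinf kap_lift kap_res rel.
have hup0 : iK up != 0 by rewrite fmorph_eq0.
have hupv : ord vh (iK up) = 1 by rewrite (ord_ext _ iw).
pose b := partial_sum jK (iK up) a.
have [alpha lim] : exists alpha, forall n : nat, vge vC n%:R (alpha - jC (b n)).
  apply: (completion_series cC (u := jC \o b)) => n /=.
  rewrite -rmorphB (vge_ext _ _ gw) /b partial_sumS addrAC subrr add0r -[n%:R]add0r.
  rewrite vgeM //; first by case: (Sa n).
  by rewrite vge_ord // ordX ?fmorph_eq0 // (ord_ext _ jw) hupv.
have na : ~ exists x, alpha = jC x.
  move=> [x ax]; apply: (limit_not_algebraic Ww jw L_closure.2 hup0 hupv Sa (x := x)).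
  by move=> n; rewrite -(vge_ext _ _ gw) rmorphB -ax; apply: lim.
exists alpha; split=> //; have tr := outside_transcendental na.
have [ev hev] := ratfun_eval_morph tr.
have evp p : ev (tofrac p) = (map_poly emb p).[alpha].
  by rewrite hev ratfun_eval_poly.
pose wE := pullback ev vC; exists wE; split; last first.
  by move=> x; rewrite /wE /= hev.
have pint (p : {poly K}) : p != 0 -> ord wE (tofrac p) \is a Num.int.
  move=> p0; rewrite /ord /= evp -/(ord _ _).
  have -> : map_poly emb p = map_poly (jC \o jK) (map_poly iK p).
    by rewrite -map_poly_comp.
  apply: (limit_order_int jw hup0 hupv Sa gw lim).
  by rewrite -map_poly_comp; apply: (eval_neq0 tr p0).
apply: (@ord_normalized _ wE (ratfun_cst K up)).
- move=> x; have [p [q [q0 ->]]] := ratfun_frac x => x0.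
  have p0 : p != 0 by apply: contraNneq x0 => ->; rewrite rmorph0 mul0r.
  by rewrite ordM ?invr_eq0 ?tofrac_eq0 // ordV ?tofrac_eq0 // rpredB ?pint.
- by rewrite fmorph_eq0.
by rewrite /ord /= evp map_polyC hornerC -/(ord _ _) (ord_ext _ ew).
Qed.

End Main.

Theorem proposition4p11
  (* V is a DVR with quotient field K, valuation v and perfect residue field *)
  (K : fieldType) (V : valuation_ring K) (v : valuation K)
  (V_DVR : DVR_with_valuation V v)
  (kv_perfect : perfect_field (residue_field V))
  (* an algebraic closure of the residue field *)
  (kbar : fieldType) (ik : {rmorphism residue_field V -> kbar})
  (kbar_closure : is_algebraic_closure ik)
  (* the v-adic completion of K *)
  (Khat : fieldType) (vhat : valuation Khat) (iK : {rmorphism K -> Khat})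
  (Khat_completion : is_completion v vhat iK)
  (* an algebraic closure of Khat, with the extension of the valuation *)
  (Kbar : fieldType) (vbar : valuation Kbar) (jK : {rmorphism Khat -> Kbar})
  (Kbar_closure : is_algebraic_closure jK)
  (vbar_extends : extends_valuation jK vhat vbar)
  (* the completion of that algebraic closure *)
  (C : fieldType) (vC : valuation C) (jC : {rmorphism Kbar -> C})
  (C_completion : is_completion vbar vC jC) :
  let emb : {rmorphism K -> C} := jC \o jK \o iK in
  let cond1 := ~ finite_degree ik in
  let cond2 := exists alpha : C,
    ~ (exists a : Kbar, alpha = jC a) /\ is_DVR (V_at emb vC alpha) in
  let cond3 := exists W : valuation_ring (ratfun K),
    [/\ extends_ring (ratfun_cst K) V W,
        is_DVR W,
        algebraic_ext (@residue_map _ _ (ratfun_cst K) V W)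
      & ~ finite_degree (@residue_map _ _ (ratfun_cst K) V W)] in
  [/\ forall alpha : C, ~ (exists a : Kbar, alpha = jC a) ->
        ~ algebraicOver emb alpha,
      [<-> cond1; cond2; cond3],
      cond1 <-> ~ algebraically_closed (residue_field V) /\
                ~ real_closed_field (residue_field V),
      finite_field (residue_field V) -> cond1
    & number_field (residue_field V) -> cond1].
Proof.
move=> emb cond1 cond2 cond3; split.
- exact: (outside_transcendental Kbar_closure).
- tfae.
  + exact: (cond1_cond2 V_DVR kv_perfect kbar_closure Khat_completion Kbar_closure
      vbar_extends C_completion).
  + move=> [alpha [na dvr]].
    exact: (cond2_cond3 V_DVR Khat_completion Kbar_closure vbar_extends
      C_completion na dvr).
  + by move=> [W [h1 h2 h3 h4]]; apply: (cond3_cond1 V_DVR kv_perfect kbar_closure h1).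
- exact: infinite_closure_iff.
- exact: (infinite_closure_finite_field kbar_closure.1).
- exact: (infinite_closure_number_field kbar_closure.1).
Qed.
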